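(* Let $u$ be a sufficiently smooth solution of $\partial_tu=\beta\partial_x^qu$ on a bounded interval $\Omega$ with periodic boundary condition, where $q=2\gamma$ ($\gamma\ge1$) or $q=2\gamma+1$ ($\gamma\ge0$), $\beta$ is a constant, and $\beta(-1)^\gamma<0$ if $q=2\gamma$. Let $\theta_0,\dots,\theta_\gamma$ be real constants with $\theta_i\neq\tfrac12$ for all $i$ and, if $q=2\gamma+1$, $\beta(-1)^\gamma(\theta_0-\tfrac12)\le0$. Let $L_h$ be the LDG operator $$L_h=\begin{cases}\beta(-1)^\gamma K_h^\top K_h,&q=2\gamma,\\ \beta(-1)^\gamma K_h^\top D_{h,\theta_0}K_h,&q=2\gamma+1,\end{cases}\qquad K_h=D_{h,\theta_1}D_{h,\theta_2}\cdots D_{h,\theta_\gamma},$$ and let $u_h^{n+1}=R_s(\tau L_h)u_h^n$ be its discretization by an explicit RK method of order $p\ge1$, with $u_h^0=\Pi u(0)$, under a time step restriction for which $\|R_s(\tau L_h)\|\le1+\mu_h\tau$ with a constant $\mu_h\ge0$. Then for all $n\ge0$ $$\|u(t^n)-u_h^n\|\le C_{\rm E}\big(\sigma(\mu_h,t^n)+1\big)\big(h^{k+1}+\tau^p\big),$$ where $C_{\rm E}$ is a constant independent of $h,\tau,n$, depending on $\{\alpha_i\}_{i=0}^s$ and Sobolev norms of $u$.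
   Context: Let $\Omega=\bigcup_{j=1}^NI_j$, $I_j=[x_{j-1/2},x_{j+1/2}]$, be a quasi-uniform partition (mesh size $0<h\le1$) of a bounded interval, periodic ($x_{1/2}$ and $x_{N+1/2}$ identified). $\langle\cdot,\cdot\rangle$ and $\|\cdot\|$ are the $L^2(\Omega)$ inner product and norm. $V_h=\{v_h\in L^2(\Omega):v_h|_{I_j}\in P^k(I_j)\ \forall j\}$ with $P^k$ the polynomials of degree at most $k$. $v_h^\mp$ are left/right limits at cell interfaces and $[v_h]=v_h^+-v_h^-$. $\Pi_0:L^2(\Omega)\to V_h$ is the $L^2$ projection. For $\theta\in\mathbb{R}$, $D_{h,\theta}:V_h\to V_h$ is defined by $$\langle D_{h,\theta}w_h,v_h\rangle=-\langle w_h,\partial_xv_h\rangle-\sum_{j=1}^N(\widehat{w_h})_{j+1/2}[v_h]_{j+1/2}\quad\forall w_h,v_h\in V_h,\qquad \widehat{w_h}=\theta w_h^-+(1-\theta)w_h^+,$$ with $\partial_xv_h$ taken cellwise. ${}^\top$ denotes the adjoint on $V_h$ with respect to $\langle\cdot,\cdot\rangle$; one has $D_{h,\theta}^\top=-D_{h,1-\theta}$, so $K_h^\top=(-1)^\gamma D_{h,1-\theta_\gamma}\cdots D_{h,1-\theta_1}$; $K_h=I$ if $\gamma=0$. Let $Z_h=\{z_h\in V_h:\langle z_h,1\rangle=0\}$; for $\theta\ne\frac12$, $D_{h,\theta}$ restricts to a bijection of $Z_h$, with inverse $D_{h,\theta}^{-1}:Z_h\to Z_h$. The operator $\Pi$ used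 for the initial data is, for smooth periodic $w$, $$\Pi w=\big(D_{h,\theta_\gamma}^{-1}\cdots D_{h,\theta_1}^{-1}\big)\,S\,\big(D_{h,1-\theta_1}^{-1}\cdots D_{h,1-\theta_\gamma}^{-1}\big)\Pi_0\partial_x^qw+\frac{\langle w,1\rangle}{\langle1,1\rangle},$$ with $S=I$ if $q=2\gamma$ and $S=D_{h,\theta_0}^{-1}$ if $q=2\gamma+1$. Time discretization: $R_s(\tau L_h)=\sum_{i=0}^s\alpha_i(\tau L_h)^i$ with $\alpha_i=1/i!$ for $0\le i\le p$ and $\alpha_{p+1}\neq1/(p+1)!$ ($\alpha_i=0$ for $i>s$); $t^n=n\tau$; standing conventions $\tau\le1$ and $\tau\|L_h\|\le\lambda<1$. ''Sufficiently smooth'' means that all $x$- and $t$-derivatives of $u$ needed exist, are periodic in $x$, and are bounded uniformly in $t\ge0$. For $a\ge0$: $\sigma(a,t)=(e^{at}-1)/a$ if $a>0$, $\sigma(0,t)=t$. *)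

(* Defs.v *)
From HB Require Import structures.
From mathcomp Require Import all_boot all_order all_algebra.
From mathcomp Require Export qpoly.
From mathcomp Require Import all_classical all_reals all_analysis.
Import Order.TTheory GRing.Theory Num.Theory numFieldNormedType.Exports.
Set Implicit Arguments.
Unset Strict Implicit.
Unset Printing Implicit Defensive.
Local Open Scope classical_set_scope.
Local Open Scope ring_scope.

(* Nodes are numbered from 0: cell j < N is [node j, node j.+1], so that
   node j is x_{j+1/2} in the usual DG notation.  Values of node beyond N are
   irrelevant. *)
Record mesh (R : realType) (a b : R) := Mesh {
  ncell : nat;
  node : nat -> R;
  node_first : node 0%N = a;
  node_last : node ncell = b;
  node_incr : forall j, (j < ncell)%N -> node j < node j.+1
}.

Definition mesh_size (R : realType) (a b : R) (M : mesh a b) : R :=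
  \big[Num.max/0]_(j < ncell M) (node M j.+1 - node M j).

Definition quasi_uniform (R : realType) (a b : R) (rho : R) (M : mesh a b) :=
  forall j : 'I_(ncell M), mesh_size M <= rho * (node M j.+1 - node M j).

Definition ip (R : realType) (a b : R) (f g : R -> R) : R :=
  \int[lebesgue_measure]_(x in `[a, b]) (f x * g x).

Definition L2norm (R : realType) (a b : R) (f : R -> R) : R :=
  Num.sqrt (ip a b f f).

(* Elements of V_h, as one polynomial of size at most k + 1 (degree at most k)
   per cell. *)
Notation Vh M k := {ffun 'I_(ncell M) -> {poly_(k.+1) _}}.

Section LDG.
Variables (R : realType) (a b : R) (M : mesh a b) (k : nat).
Local Notation N := (ncell M).
Local Notation V := {ffun 'I_N -> {poly_(k.+1) R}}.

(* The function equal to p_j on the j-th cell (right endpoint excluded). *)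
Definition glue (p : 'I_N -> {poly R}) (x : R) : R :=
  \sum_(j < N | node M j <= x < node M j.+1) (p j).[x].

Definition broken (v : V) : R -> R := glue (fun j => v j).

Definition broken_deriv (v : V) : R -> R := glue (fun j => (val (v j))^`()).

Definition ipV (v w : V) : R := ip a b (broken v) (broken w).

Definition normV (v : V) : R := L2norm a b (broken v).

(* The interface j is the right end of cell j; the cell on its right is
   ordS j, which is cell 0 when j is the last cell (periodicity). *)
Definition trace_left (v : V) (j : 'I_N) : R := (val (v j)).[node M j.+1].

Definition trace_right (v : V) (j : 'I_N) : R :=
  (val (v (ordS j))).[node M (ordS j)].

Definition jump (v : V) (j : 'I_N) : R := trace_right v j - trace_left v j.

Definition flux (theta : R) (w : V) (j : 'I_N) : R :=
  theta * trace_left w j + (1 - theta) * trace_right w j.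

(* Since ipV is an inner product on the finite-dimensional space V, exactly
   one operator satisfies the defining identity (Riesz); likewise for the
   adjoint and the L2 projection below. *)
Definition Dop (theta : R) : 'End(V) :=
  xget 0 [set D : 'End(V) | forall w v : V,
    ipV (D w) v = - ip a b (broken w) (broken_deriv v)
                  - \sum_(j < N) flux theta w j * jump v j].

Definition adjoint (A : 'End(V)) : 'End(V) :=
  xget 0 [set B : 'End(V) | forall v w : V, ipV (B v) w = ipV v (A w)].

Definition L2proj (f : R -> R) : V :=
  xget 0 [set p : V | forall v : V, ipV p v = ip a b f (broken v)].

Definition constV (c : R) : V := [ffun=> npolyp k.+1 c%:P].

Definition Zh : set V := [set z | ip a b (broken z) (cst 1) = 0].

(* The inverse of Dop theta restricted to Zh, for theta != 1/2; it is only
   meaningful on Zh. *)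
Definition Dinv (theta : R) (f : V) : V :=
  xget 0 [set z : V | Zh z /\ Dop theta z = f].

Definition opnorm (A : 'End(V)) : R :=
  sup [set normV (A v) | v in [set v : V | normV v <= 1]].

Definition Kop (gamma : nat) (theta : nat -> R) : 'End(V) :=
  \big[@comp_lfun R V V V / \1%VF]_(1 <= i < gamma.+1) Dop (theta i).

Definition Lop (q gamma : nat) (beta : R) (theta : nat -> R) : 'End(V) :=
  let K := Kop gamma theta in
  (beta * (-1) ^+ gamma) *:
    (if odd q then (adjoint K \o (Dop (theta 0%N) \o K))%VF
     else (adjoint K \o K)%VF).

Definition Rs (s : nat) (alpha : nat -> R) (A : 'End(V)) : 'End(V) :=
  \sum_(i < s.+1) alpha i *: iter i (@comp_lfun R V V V A) \1%VF.

(* foldr applies the last index of the list first. *)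
Definition Pi_init (q gamma : nat) (theta : nat -> R) (w : R -> R) : V :=
  let right := foldr (fun i v => Dinv (1 - theta i) v)
                 (L2proj (derive1n q w)) (iota 1 gamma) in
  let middle := if odd q then Dinv (theta 0%N) right else right in
  let left := foldr (fun i v => Dinv (theta i) v)
                middle (rev (iota 1 gamma)) in
  left + constV (ip a b w (cst 1) / ip a b (cst 1) (cst 1)).

End LDG.

(* u is C^m on [0, +oo[ x R, with Du i j = d_t^i d_x^j u for i + j <= m: the
   t-derivatives are taken for t > 0, and all derivatives extend continuously
   up to t = 0. *)
Definition smooth_derivs (R : realType) (m : nat) (u : R -> R -> R)
    (Du : nat -> nat -> R -> R -> R) : Prop :=
  [/\ forall t x : R, 0 <= t -> Du 0%N 0%N t x = u t x,
      forall (i j : nat) (t x : R), (i + j < m)%N -> 0 <= t ->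
        is_derive x 1 (Du i j t) (Du i j.+1 t x),
      forall (i j : nat) (t x : R), (i + j < m)%N -> 0 < t ->
        is_derive t 1 (fun r => Du i j r x) (Du i.+1 j t x) &
      forall i j : nat, (i + j <= m)%N ->
        {within [set z : R * R | 0 <= z.1],
          continuous (fun z : R * R => Du i j z.1 z.2)}].

Definition sobolev_norm (R : realType) (a b : R) (m : nat)
    (Du : nat -> nat -> R -> R -> R) (t : R) : R :=
  Num.sqrt (\sum_(i < m.+1) \sum_(j < m.+1 | (i + j <= m)%N)
              L2norm a b (Du i j t) ^+ 2).

Definition sigma_growth (R : realType) (mu t : R) : R :=
  if mu == 0 then t else (expR (mu * t) - 1) / mu.

(* Main.v *)
Require Import Defs.
From mathcomp Require Import all_boot all_order all_algebra.
From mathcomp Require Import all_classical all_reals all_analysis.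
From mathcomp Require Import ring lra zify.
From HB Require Import structures.
Import Order.TTheory GRing.Theory Num.Theory numFieldNormedType.Exports.
Set Implicit Arguments.
Unset Strict Implicit.
Unset Printing Implicit Defensive.
Local Open Scope classical_set_scope.
Local Open Scope ring_scope.

(** The semidiscrete operator is a product of biased difference operators:
    with [Lam] the composition of the [q] operators [Dop t], [t] ranging over
    [factors], one has [Lop = beta *: Lam] ([LopE]), because the adjoint of
    [Dop t] is [- Dop (1 - t)].  The initial operator [Pi_init] inverts this
    product: [Lam (Pi_init w)] is the L2 projection of the [q]-th derivative
    of [w], and [Pi_init w] has the mean of [w] ([Pi_initE]).  Everything in
    space then reduces to one estimate, proved in the maximum norm
    ([Dop_error]): if [w] is smooth, [Dop t z] is within [A] of [w'], and [z]
    and [w] have the same mean, then [z] is within [C (A + h^(k+1))] of [w].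
    It contains the stability of the inverse of [Dop t] on mean-zero functions
    (take [w = 0]) and, applied [q] times, the optimal accuracy of [Pi_init]
    ([Dchain_error]).

    To prove it, let [F] be the cellwise antiderivative of [Dop t z] whose
    value at the left end of each cell is the numerical flux of [z] there.
    Testing the definition of [Dop t] with functions supported on one cell
    shows that [F] also takes the flux at the right end, so [F] is continuous
    and periodic, and that [z - F] is orthogonal to polynomials of degree less
    than [k] on each cell ([flux_antiderivative]).  Now [F] is close to [w] up
    to an additive constant, hence close to polynomials on each cell, and the
    difference [r] between [z] and these polynomials is almost orthogonal to
    lower degree.  Such an [r] is controlled by its value at one end of the
    cell, and its values at both ends have almost the same modulus
    ([cell_estimate]).  The flux relation then couples neighbouring cells with
    weights [|t|] and [|1 - t|]; as these differ, a maximum argument around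
    the periodic mesh bounds all end values ([cyclic_bound]), without any loss
    of powers of the mesh size.

    In time, the equation gives [L Pi u_i = Pi u_(i+1)] up to [O(h^(k+1))],
    where [u_i] is the [i]-th time derivative ([L_Pi]).  Since [tau L] is a
    contraction, [(tau L)^i Pi u] is [tau^i Pi u_i] up to
    [O(tau h^(k+1))] ([iter_Pi]), and inserting Taylor's formula in [R_s]
    shows that [Pi u] satisfies the scheme up to
    [tau O(h^(k+1) + tau^p)] ([local_error]).  The stability bound on [R_s]
    and a discrete Gronwall argument sum these local errors
    ([global_error]). *)

(** * Integrals of continuous functions over an interval *)

Section CellIntegral.
Variable R : realType.
Implicit Types (c d x y : R) (f g F : R -> R) (p : {poly R}).

Definition integ c d f : R := \int[lebesgue_measure]_(x in `[c, d]) f x.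

Lemma cont_integrable c d f : continuous f ->
  lebesgue_measure.-integrable `[c, d] (EFin \o f).
Proof.
move=> cf; apply: continuous_compact_integrable; first exact: segment_compact.
exact: continuous_subspaceT.
Qed.

Lemma integD c d f g : continuous f -> continuous g ->
  integ c d (fun x => f x + g x) = integ c d f + integ c d g.
Proof. by move=> cf cg; rewrite /integ RintegralD//; exact: cont_integrable. Qed.

Lemma integB c d f g : continuous f -> continuous g ->
  integ c d (fun x => f x - g x) = integ c d f - integ c d g.
Proof. by move=> cf cg; rewrite /integ RintegralB//; exact: cont_integrable. Qed.

Lemma integZ c d (r : R) f : continuous f ->
  integ c d (fun x => r * f x) = r * integ c d f.
Proof. by move=> cf; rewrite /integ RintegralZl//; exact: cont_integrable. Qed.

Lemma eq_integ c d f g : (forall x, c <= x <= d -> f x = g x) ->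
  integ c d f = integ c d g.
Proof.
move=> fg; apply: eq_Rintegral => x; rewrite inE/= in_itv/=; exact: fg.
Qed.

Lemma integ_ge0 c d f : (forall x, c <= x <= d -> 0 <= f x) -> 0 <= integ c d f.
Proof. by move=> f0; apply: Rintegral_ge0 => x/=; rewrite in_itv/=; exact: f0. Qed.

Lemma le_integ c d f g : continuous f -> continuous g ->
  (forall x, c <= x <= d -> f x <= g x) -> integ c d f <= integ c d g.
Proof.
move=> cf cg fg; apply: le_Rintegral => //; try exact: cont_integrable.
Qed.

Lemma cont_norm f : continuous f -> continuous (fun x => `|f x|).
Proof. by move=> cf x; apply: cvg_norm; exact: cf. Qed.

Lemma le_norm_integ c d f : continuous f ->
  `|integ c d f| <= integ c d (fun x => `|f x|).
Proof. by move=> cf; apply: le_normr_Rintegral => //; exact: cont_integrable. Qed.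

Lemma integ_cst c d (r : R) : c <= d -> integ c d (fun=> r) = r * (d - c).
Proof.
move=> cd; rewrite /integ Rintegral_cst//.
have -> : fine (lebesgue_measure [set` `[c, d]]) = if c < d then d - c else 0.
  have -> := lebesgue_measure_itv `[c, d].
  by rewrite /= lte_fin; case: ltP.
case: ltP => //= dc; have -> : d = c by apply/le_anti; rewrite cd dc.
by rewrite subrr.
Qed.

Lemma is_derive_cont F f x : is_derive x 1 F (f x) -> {for x, continuous F}.
Proof. by case=> dF _; apply/differentiable_continuous/derivable1_diffP. Qed.

Lemma integ_FTC c d F f : c <= d -> continuous f ->
  (forall x, is_derive x 1 F (f x)) -> integ c d f = F d - F c.
Proof.
rewrite le_eqVlt => /predU1P[<-|cd] cf dF.
  by rewrite /integ set_itv1 Rintegral_set1 subrr.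
rewrite /integ /Rintegral (continuous_FTC2 cd _ (F := F)) //.
- exact: continuous_subspaceT.
- split.
  + by move=> x _; case: (dF x).
  + by apply: cvg_at_right_filter; exact: (is_derive_cont (dF c)).
  + by apply: cvg_at_left_filter; exact: (is_derive_cont (dF d)).
- by move=> x _; rewrite derive1E; exact: derive_val.
Qed.

Lemma bound_integ c d f (A : R) : c <= d -> continuous f ->
  (forall x, c <= x <= d -> `|f x| <= A) -> `|integ c d f| <= A * (d - c).
Proof.
move=> cd cf fA; apply: le_trans (le_norm_integ _ _ cf) _.
rewrite -integ_cst//; apply: le_integ => //; first exact: cont_norm.
by move=> x; exact: cst_continuous.
Qed.

Lemma integ_poly c d p : c <= d ->
  forall q, q^`() = p -> integ c d (horner p) = q.[d] - q.[c].
Proof.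
move=> cd q <-; apply: integ_FTC => //; first exact: continuous_horner.
Qed.

Definition prim p : {poly R} := \poly_(i < (size p).+1) (p`_i.-1 / i%:R).

Lemma coef_prim p i : (prim p)`_i = p`_i.-1 / i%:R.
Proof.
rewrite coef_poly; case: ltnP => // pi.
by rewrite nth_default ?mul0r//; case: i pi.
Qed.

Lemma primK p : (prim p)^`() = p.
Proof.
apply/polyP => i; rewrite coef_deriv coef_prim /=.
by rewrite -[LHS]mulr_natr divfK// pnatr_eq0.
Qed.

Lemma size_prim p : (size (prim p) <= (size p).+1)%N.
Proof. exact: size_poly. Qed.

End CellIntegral.

Lemma cont_poly (R : realType) (p : {poly R}) : continuous (horner p).
Proof. exact: continuous_horner. Qed.

Lemma contD (R : realType) (f g : R -> R) : continuous f -> continuous g ->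
  continuous (fun x => f x + g x).
Proof. by move=> cf cg x; apply: cvgD; [exact: cf|exact: cg]. Qed.

Lemma contB (R : realType) (f g : R -> R) : continuous f -> continuous g ->
  continuous (fun x => f x - g x).
Proof. by move=> cf cg x; apply: cvgB; [exact: cf|exact: cg]. Qed.

Lemma contM (R : realType) (f g : R -> R) : continuous f -> continuous g ->
  continuous (fun x => f x * g x).
Proof. by move=> cf cg x; apply: cvgM; [exact: cf|exact: cg]. Qed.

Lemma cont_cst (R : realType) (r : R) : continuous (fun _ : R => r).
Proof. by move=> x; exact: cst_continuous. Qed.

(** Evaluation rules that keep products in the plain form expected by [ring]. *)
Definition hornerS := (hornerD, hornerN, hornerM, hornerZ, hornerC, hornerX).

Lemma size_derivW (R : realType) (p : {poly R}) n :
  (size p <= n.+1)%N -> (size p^`() <= n)%N.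
Proof.
have [->|p0] := eqVneq p 0; first by rewrite deriv0 size_poly0.
by move=> pn; rewrite -ltnS; exact: leq_trans (lt_size_deriv p0) pn.
Qed.

(** * Inner products on finite-dimensional spaces *)

Section Riesz.
Variables (R : realFieldType) (V : vectType R) (B : V -> V -> R).
Hypothesis Blin : forall x u v w, B (x *: u + v) w = x * B u w + B v w.
Hypothesis Bsym : forall u v, B u v = B v u.
Hypothesis Bpos : forall u, u != 0 -> 0 < B u u.

Lemma form0l w : B 0 w = 0.
Proof.
by have := Blin (-1) 0 0 w; rewrite scaler0 addr0 mulN1r addNr.
Qed.

Lemma formDl u v w : B (u + v) w = B u w + B v w.
Proof. by have := Blin 1 u v w; rewrite scale1r mul1r. Qed.

Lemma formZl x u w : B (x *: u) w = x * B u w.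
Proof. by have := Blin x u 0 w; rewrite addr0 form0l addr0. Qed.

Lemma formBl u v w : B (u - v) w = B u w - B v w.
Proof. by rewrite formDl -scaleN1r formZl mulN1r. Qed.

Lemma form_ge0 u : 0 <= B u u.
Proof.
by case: (eqVneq u 0) => [->|/Bpos/ltW//]; rewrite form0l.
Qed.

Lemma form_eq u v : (forall w, B u w = B v w) -> u = v.
Proof.
move=> uv; apply/eqP; rewrite -subr_eq0; apply/negPn/negP => /Bpos.
by rewrite formBl uv subrr ltxx.
Qed.

Lemma form_CS u v : B u v ^+ 2 <= B u u * B v v.
Proof.
have [->|/Bpos vv] := eqVneq v 0.
  by rewrite Bsym !form0l expr0n mulr0.
have := form_ge0 (B v v *: u - B u v *: v).
rewrite formBl !formZl (Bsym u) (Bsym v (_ - _)) !formBl !formZl (Bsym v u).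
move=> H; rewrite -subr_ge0 -(pmulr_rge0 _ vv); apply: le_trans H _.
by rewrite le_eqVlt; apply/orP; left; apply/eqP; ring.
Qed.

(** The linear map sending [u] to its products with a basis is injective
    because the form is definite, hence onto by dimension. *)
Lemma riesz (phi : V -> R) :
  (forall x u v, phi (x *: u + v) = x * phi u + phi v) ->
  exists r, forall v, B r v = phi v.
Proof.
move=> philin.
pose n := \dim (fullv : {vspace V}); pose e := vbasis (fullv : {vspace V}).
pose f (v : V) : 'rV[R]_n := \row_i B v e`_i.
have flin : linear f.
  by move=> x u v; apply/rowP => i; rewrite !mxE Blin.
pose L : {linear V -> 'rV[R]_n} := HB.pack f (GRing.isLinear.Build _ _ _ _ f flin).
pose g := linfun L.
have decomp (psi : V -> R) :
    (forall x u v, psi (x *: u + v) = x * psi u + psi v) ->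
    forall v, psi v = \sum_(i < n) coord e i v * psi e`_i.
  move=> pl v.
  have p0 : psi 0 = 0 by move: (pl (-1) 0 0); rewrite scaler0 addr0 mulN1r addNr.
  
  rewrite {1}(coord_vbasis (memvf v)).
  elim/big_ind2: _ => //= [x u y w <- <-|i _].
    by have := pl 1 u w; rewrite scale1r mul1r.
  by have := pl (coord e i v) e`_i 0; rewrite !addr0 p0 addr0.
have g0 : lker g == 0%VS.
  apply/lker0P => u v; rewrite !lfunE /= => /rowP uv; apply: form_eq => w.
  rewrite (decomp (fun z => B u z)) ?(decomp (fun z => B v z)).
    by apply: eq_bigr => i _; have := uv i; rewrite !mxE => ->.
  - by move=> x a b; rewrite Bsym Blin (Bsym a) (Bsym b).
  - by move=> x a b; rewrite Bsym Blin (Bsym a) (Bsym b).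
have gfull : limg g = fullv.
  apply/eqP; rewrite eqEdim subvf /=.
  have := limg_ker_dim g fullv; rewrite (eqP g0) capv0 dimv0 add0n => ->.
  by rewrite dimvf /dim /= mul1n.
have /memv_imgP[r _ rE] : (\row_i phi e`_i : 'rV[R]_n) \in limg g.
  by rewrite gfull memvf.
exists r => v; rewrite (decomp phi)// (decomp (fun z => B r z)).
  by apply: eq_bigr => i _; move/rowP/(_ i): rE; rewrite lfunE /= !mxE => ->.
by move=> x a b; rewrite Bsym Blin (Bsym a) (Bsym b).
Qed.

(** Equivalence of norms in finite dimension, in the form in which it is
    used: every linear functional is bounded by the norm of the form. *)
Lemma functional_bound (phi : V -> R) :
  (forall x u v, phi (x *: u + v) = x * phi u + phi v) ->
  exists2 C, 0 <= C & forall v, phi v ^+ 2 <= C * B v v.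
Proof.
move=> /riesz[r rE]; exists (B r r); first exact: form_ge0.
by move=> v; rewrite -rE form_CS.
Qed.

Lemma operator_of_form (b : V -> V -> R) :
  (forall x u v w, b (x *: u + v) w = x * b u w + b v w) ->
  (forall x u v w, b w (x *: u + v) = x * b w u + b w v) ->
  exists A : 'End(V), forall w v, B (A w) v = b w v.
Proof.
move=> bl br.
have /boolp.choice[f fE] : forall w, exists r, forall v, B r v = b w v.
  by move=> w; apply: riesz => x u v; exact: br.
have flin : linear f.
  by move=> x u v; apply: form_eq => w; rewrite Blin !fE bl.
pose L : {linear V -> V} := HB.pack f (GRing.isLinear.Build _ _ _ _ f flin).
by exists (linfun L) => w v; rewrite lfunE fE.
Qed.

End Riesz.

(** * Inverse inequalities for polynomials *)

Section PolynomialInequalities.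
Variable R : realType.
Implicit Types (c d x y : R) (p q r s : {poly R}).

(** The antiderivative of [p] is monotone with equal end values, so it is
    constant on an interval, hence as a polynomial. *)
Lemma poly_nonneg_integ0 c d p : c < d ->
  (forall x, c <= x <= d -> 0 <= p.[x]) -> integ c d (horner p) = 0 -> p = 0.
Proof.
move=> cd p0 I0; pose P := prim p - (prim p).[c]%:P.
have PK : P^`() = p by rewrite derivB derivC subr0 primK.
have Pc : P.[c] = 0 by rewrite !hornerS subrr.
have root_P x : c <= x <= d -> root P x.
  move=> /andP[cx xd]; apply/rootP/le_anti/andP; split.
  - have := integ_poly (ltW cd) PK; rewrite I0 Pc subr0 => Pd.
    suff: 0 <= P.[d] - P.[x] by rewrite -Pd sub0r oppr_ge0.
    rewrite -(integ_poly xd PK).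
    by apply: integ_ge0 => y /andP[xy yd]; rewrite p0// yd (le_trans cx).
  - suff: 0 <= P.[x] - P.[c] by rewrite Pc subr0.
    rewrite -(integ_poly cx PK).
    by apply: integ_ge0 => y /andP[cy yx]; rewrite p0// cy (le_trans yx).
have P0 : P = 0.
  apply/eqP; apply: contraT => Pn0.
  pose t (i : nat) := c + (d - c) / i.+1%:R.
  have := max_poly_roots Pn0 (rs := [seq t i | i <- iota 0 (size P)]).
  rewrite size_map size_iota ltnn; apply.
  - apply/allP => _ /mapP[i _ ->]; apply: root_P.
    rewrite lerDl divr_ge0 ?subr_ge0 ?(ltW cd)//=.
    rewrite -lerBrDl ler_pdivrMr ?ltr0n// ler_peMr ?subr_ge0 ?(ltW cd)//.
    by rewrite ler1n.
  - rewrite map_inj_uniq ?iota_uniq// => i j /addrI/mulfI.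
    rewrite subr_eq0 gt_eqF// => /(_ isT)/invr_inj/eqP.
    by rewrite eqr_nat => /eqP[].
by rewrite -PK P0 deriv0.
Qed.

(** Squared L2 norm with weight [d - x].  The weight comes from writing
    [r = r(d) + (x - d) s]: testing [r] against [s] produces
    [wnorm2 c d s]. *)
Definition wnorm2 c d p : R := integ c d (horner ((d%:P - 'X) * p * p)).

Lemma wnorm2_ge0 c d p : 0 <= wnorm2 c d p.
Proof.
apply: integ_ge0 => x /andP[_ xd]; rewrite !hornerS -mulrA mulr_ge0//.
  by rewrite subr_ge0.
by rewrite -expr2 sqr_ge0.
Qed.

Lemma coef_bound n : exists2 C, 0 <= C &
  forall p, (size p <= n)%N -> forall i, p`_i ^+ 2 <= C * wnorm2 0 1 p.
Proof.
pose B (u v : {poly_n R}) := integ 0 1 (horner ((1%:P - 'X) * val u * val v)).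
have [Blin Bsym Bpos] : [/\ forall x u v w, B (x *: u + v) w = x * B u w + B v w,
   forall u v, B u v = B v u & forall u, u != 0 -> 0 < B u u].
  split.
  - move=> x u v w; rewrite /B -integZ; last exact: cont_poly.
    rewrite -integD; [|by apply: contM; [exact: cont_cst|exact: cont_poly]|exact: cont_poly].
    apply: eq_integ => y _; rewrite linearP/= !hornerS. ring.
  - by move=> u v; rewrite /B mulrAC.
  - move=> u u0; rewrite lt_neqAle wnorm2_ge0 andbT eq_sym.
    apply: contra u0 => /eqP/poly_nonneg_integ0 H; apply/eqP/val_inj => /=.
    have /eqP : (1%:P - 'X) * val u * val u = 0.
      apply: H => // x /andP[_ x1]; rewrite !hornerS -mulrA mulr_ge0//.
        by rewrite subr_ge0.
      by rewrite -expr2 sqr_ge0.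
    rewrite !mulf_eq0 subr_eq0 => /orP[/orP[|]|] /eqP//.
    by move=> /(congr1 (size : {poly R} -> nat)); rewrite size_polyX size_polyC oner_eq0.
have /boolp.choice[C CE] : forall i : nat, exists C, 0 <= C /\
    forall u : {poly_n R}, (val u)`_i ^+ 2 <= C * B u u.
  move=> i; have [x u v|C C0 CE] := functional_bound Blin Bsym Bpos (phi :=
    fun u => (val u)`_i).
    by rewrite linearP/= coefD coefZ.
  by exists C.
exists (\sum_(i < n) C i).
  by apply: sumr_ge0 => i _; case: (CE i).
move=> p pn i.
have W0 : 0 <= (\sum_(i < n) C i) * wnorm2 0 1 p.
  by rewrite mulr_ge0 ?wnorm2_ge0// sumr_ge0// => j _; case: (CE j).
have [ni|ni] := leqP n i.
  by rewrite nth_default ?expr0n//; exact: leq_trans ni.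
case: (CE i) => _ /(_ (npolyp n p)); rewrite /B /= npolypK// => H.
apply: le_trans H _; rewrite ler_wpM2r ?wnorm2_ge0//.
rewrite (bigD1 (Ordinal ni))//= lerDl sumr_ge0// => j _; by case: (CE j).
Qed.

(** On the unit interval all norms of polynomials of bounded size are
    equivalent, and values and derivatives are combinations of coefficients. *)
Lemma inverse_ref n : exists2 C, 0 <= C &
  forall p x, (size p <= n)%N -> 0 <= x <= 1 ->
    p.[x] ^+ 2 <= C * wnorm2 0 1 p /\ (p^`()).[x] ^+ 2 <= C * wnorm2 0 1 p.
Proof.
have [C C0 CE] := coef_bound n; exists ((n * n)%:R ^+ 2 * C).
  by rewrite mulr_ge0 ?sqr_ge0.
move=> p x pn /andP[x0 x1]; set W := wnorm2 0 1 p.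
pose t := Num.sqrt (C * W).
have t0 : 0 <= t by exact: sqrtr_ge0.
have CW : 0 <= C * W by rewrite mulr_ge0// wnorm2_ge0.
have pt i : `|p`_i| <= t.
  by rewrite -ler_sqr ?nnegrE// real_normK ?num_real// sqr_sqrtr// CE.
have sq y : `|y| <= (n * n)%:R * t -> y ^+ 2 <= (n * n)%:R ^+ 2 * C * W.
  move=> yt; rewrite -mulrA -(sqr_sqrtr CW) -exprMn -real_normK ?num_real//.
  by rewrite ler_sqr ?nnegrE// mulr_ge0.
have eval q u : (size q <= n)%N -> 0 <= u -> (forall i, `|q`_i| <= u) -> `|q.[x]| <= n%:R * u.
  move=> qn u0 qu; rewrite (horner_coef_wide _ qn); apply: le_trans (ler_norm_sum _ _ _) _.
  rewrite mulr_natl -[X in u *+ X]card_ord -sumr_const; apply: ler_sum => i _.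
  rewrite normrM -[leRHS]mulr1 ler_pM// normrX ger0_norm//.
  exact: exprn_ile1.
split; apply: sq.
- apply: le_trans (eval _ t pn t0 pt) _; rewrite ler_wpM2r// ler_nat.
  by case: n {pn CE eval} => // n; rewrite leq_pmulr.
- rewrite natrM -mulrA; apply: eval.
  + exact: size_derivW (leqW pn).
  + by rewrite mulr_ge0.
  move=> i; rewrite coef_deriv.
  have [ni|ni] := leqP n i.+1.
    case: (ltnP n i.+1) => ni'.
      by rewrite nth_default ?mul0rn ?normr0 ?mulr_ge0//; exact: leq_trans pn _.
    by rewrite normrMn -[leLHS]mulr_natl ler_pM// ler_nat.
  by rewrite normrMn -[leLHS]mulr_natl ler_pM// ler_nat ltnW.
Qed.

(** Follows from the unit interval by the affine change of variable; the
    powers of [d - c] make the constant independent of the cell. *)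
Lemma inverse_cell n : exists2 C, 0 <= C &
  forall c d p x, c < d -> (size p <= n)%N -> c <= x <= d ->
    ((d - c) * p.[x]) ^+ 2 <= C * wnorm2 c d p /\
    ((d - c) ^+ 2 * (p^`()).[x]) ^+ 2 <= C * wnorm2 c d p.
Proof.
have [C C0 CE] := inverse_ref n; exists C => // c d p x cd pn /andP[cx xd].
have dc : 0 < d - c by rewrite subr_gt0.
have dc0 : d - c != 0 by rewrite gt_eqF.
pose l : {poly R} := c%:P + (d - c) *: 'X.
have lE y : l.[y] = c + (d - c) * y by rewrite !hornerS.
have l' : l^`() = (d - c)%:P by rewrite derivD derivC derivZ derivX add0r -mul_polyC mulr1.
pose q := p \Po l; pose y := (x - c) / (d - c).
have ly : l.[y] = x by rewrite lE mulrC divfK// addrC subrK.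
have y01 : 0 <= y <= 1.
  by rewrite divr_ge0 ?subr_ge0 ?(ltW cd)//= ler_pdivrMr// mul1r lerD2r.
have qn : (size q <= n)%N.
  apply: leq_trans pn; rewrite /q; case: (eqVneq p 0) => [->|p0].
    by rewrite comp_poly0 size_poly0.
  apply: leq_trans (size_comp_poly_leq _ _) _.
  have : (size l <= 2)%N.
    rewrite (leq_trans (size_polyD _ _))// geq_max (leq_trans (size_polyC_leq1 _))//=.
    by rewrite (leq_trans (size_scale_leq _ _))// size_polyX.
  have : (0 < size p)%N by rewrite size_poly_gt0.
  case: (size l) => [|[|[|]]]//=; case: (size p) => [|m]//=; lia.
have WE : wnorm2 0 1 q = wnorm2 c d p / (d - c) ^+ 2.
  pose P := prim ((d%:P - 'X) * p * p).
  rewrite {2}/wnorm2 (integ_poly (ltW cd) (primK _)) -/P.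
  rewrite /wnorm2 (integ_poly ler01 (q := (d - c) ^- 2 *: (P \Po l))).
    have dE : c + (d - c) = d by ring.
    by rewrite !hornerZ !horner_comp !lE mulr1 mulr0 addr0 dE -mulrBr mulrC.
  rewrite derivZ deriv_comp /P primK l' !comp_polyM comp_polyB comp_polyC comp_polyX.
  rewrite -/q -mul_polyC /l -mul_polyC.
  have -> : ((d - c) ^- 2)%:P = (d - c)^-1%:P * (d - c)^-1%:P :> {poly R}.
    by rewrite -polyCM -exprVn expr2.
  have E : (d - c)^-1%:P * (d - c)%:P = 1 :> {poly R} by rewrite -polyCM mulVf.
  transitivity ((d - c)^-1%:P * ((d - c)^-1%:P * (d - c)%:P) * (d%:P - (c%:P + (d - c)%:P *
    'X)) * q * q); first by ring.
  rewrite E mulr1; congr (_ * _ * _).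
  rewrite opprD addrA -polyCB mulrBr E mulrA E mul1r; ring.
have [H1 H2] := CE q y qn y01.
move: H1 H2; rewrite /q deriv_comp l' hornerM !horner_comp ly hornerC -/q WE => H1 H2.
rewrite mulrA in H1; rewrite mulrA in H2.
move: H1 H2; rewrite !ler_pdivlMr ?exprn_gt0// => H1 H2.
by split; [apply: le_trans H1|apply: le_trans H2]; rewrite le_eqVlt; apply/orP; left;
  apply/eqP; ring.
Qed.

End PolynomialInequalities.

(** * Polynomials almost orthogonal to lower degree *)

Section CellEstimate.
Variable R : realType.
Implicit Types (c d x y : R) (p q r s : {poly R}).

(** If [r] is orthogonal to lower degree ([e = 0]), then
    [r = r(d) + (x - d) s] tested against [s] bounds [s] by [r(d)], and
    [r(d)^2 - r(c)^2] is twice the integral of [r r'], which vanishes.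
    Both arguments are stable under a perturbation of size [e]. *)
Lemma cell_estimate (k : nat) : exists2 C : R, 0 <= C &
  forall c d r (e : R), c < d -> (size r <= k.+1)%N -> 0 <= e ->
  (forall s (S : R), (size s <= k)%N -> (forall x, c <= x <= d -> `|s.[x]| <= S) ->
     `|integ c d (horner (r * s))| <= e * (d - c) * S) ->
  [/\ forall x, c <= x <= d -> `|r.[x]| <= C * (e + `|r.[d]|),
      `|r.[c]| <= `|r.[d]| + C * e & `|r.[d]| <= `|r.[c]| + C * e].
Proof.
have [K K0 KE] := inverse_cell R k.+1.
pose L := Num.sqrt K * (1 + K).
have K1 : 0 <= 1 + K by rewrite addr_ge0.
have L0 : 0 <= L by rewrite mulr_ge0 ?sqrtr_ge0// addr_ge0.
exists (1 + K + (2 * L + 2)); first by lra.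
move=> c d r e cd rk e0 rs.
have dc : 0 < d - c by rewrite subr_gt0.
have e1 : 0 <= e + `|r.[d]| by rewrite addr_ge0.
have bound x : c <= x <= d -> `|r.[x]| <= (1 + K) * (e + `|r.[d]|).
  move=> cxd; have [cx xd] := andP cxd.
  have /factor_theorem[s sE] : root (r - (r.[d])%:P) d.
    by rewrite rootE !hornerS subrr.
  have {sE}rE : r = (r.[d])%:P + s * ('X - d%:P) by rewrite -sE addrC subrK.
  have sk : (size s <= k)%N.
    have [->|s0] := eqVneq s 0; first by rewrite size_poly0.
    have : (size (r - (r.[d])%:P)%R <= k.+1)%N.
      rewrite (leq_trans (size_polyD _ _))// geq_max rk size_polyN.
      by rewrite (leq_trans (size_polyC_leq1 _)).
    by rewrite {1}rE addrAC subrr add0r size_Mmonic ?monicXsubC// size_XsubC addn2.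
  set Q := wnorm2 c d s; have Q0 : 0 <= Q by exact: wnorm2_ge0.
  pose t := Num.sqrt Q; pose u := Num.sqrt K.
  have t0 : 0 <= t by exact: sqrtr_ge0.
  have u0 : 0 <= u by exact: sqrtr_ge0.
  have tQ : t ^+ 2 = Q by rewrite sqr_sqrtr.
  have uK : u ^+ 2 = K by rewrite sqr_sqrtr.
  have sS y : c <= y <= d -> (d - c) * `|s.[y]| <= u * t.
    move=> cyd; have [H _] := KE c d s y cd (leqW sk) cyd.
    rewrite -[X in X * _]gtr0_norm// -normrM -[leRHS]ger0_norm ?mulr_ge0//.
    by rewrite -ler_sqr ?nnegrE// !real_normK ?num_real// [leRHS]exprMn uK tQ.
  pose S := u * t / (d - c).
  have sS' y : c <= y <= d -> `|s.[y]| <= S.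
    by move=> cyd; rewrite ler_pdivlMr// mulrC sS.
  have QE : Q = r.[d] * integ c d (horner s) - integ c d (horner (r * s)).
    rewrite -integZ; last exact: cont_poly.
    rewrite -integB; [|by apply: contM; [exact: cont_cst|exact: cont_poly]|exact: cont_poly].
    apply: eq_integ => y _; rewrite [in (r * s).[y]]rE !hornerS; ring.
  have QS : Q <= (e + `|r.[d]|) * (d - c) * S.
    rewrite QE; apply: le_trans (ler_norm _) _.
    apply: le_trans (ler_normB _ _) _; rewrite normrM.
    have H1 := rs s S sk sS'.
    have H2 := bound_integ (ltW cd) (@cont_poly R s) sS'.
    have H3 : `|r.[d]| * `|integ c d (horner s)| <= `|r.[d]| * (S * (d - c)) by rewrite
      ler_wpM2l.
    lra.
  have SE : (d - c) * S = u * t by rewrite /S mulrC divfK// gt_eqF.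
  have tt : t <= (e + `|r.[d]|) * u.
    have [->|tn0] := eqVneq t 0; first by rewrite mulr_ge0.
    rewrite -mulrA SE -tQ expr2 mulrA in QS.
    by rewrite -(ler_pM2r (_ : 0 < t))// lt_neqAle t0 andbT eq_sym.
  have Hs : (d - x) * `|s.[x]| <= K * (e + `|r.[d]|).
    apply: le_trans (_ : (d - c) * `|s.[x]| <= _); first by rewrite ler_wpM2r// lerB.
    apply: le_trans (sS x cxd) _; rewrite -uK expr2 -mulrA.
    by rewrite ler_wpM2l// mulrC.
  have -> : r.[x] = r.[d] + s.[x] * (x - d) by rewrite {1}rE !hornerS.
  apply: le_trans (ler_normD _ _) _; rewrite normrM [`|x - d|]distrC (ger0_norm (_ : 0 <= d
    - x)) ?subr_ge0//.
  rewrite mulrC in Hs; lra.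
(* The inverse inequality bounds r' by the maximum of r over the cell
   length, which makes r' an admissible test function. *)
have diff : `|r.[d] ^+ 2 - r.[c] ^+ 2| <= 2 * e * L * (e + `|r.[d]|).
  pose b := (1 + K) * (e + `|r.[d]|).
  have b0 : 0 <= b by rewrite mulr_ge0// addr_ge0.
  have W : wnorm2 c d r <= (d - c) ^+ 2 * b ^+ 2.
    apply: le_trans (ler_norm _) _.
    have -> : (d - c) ^+ 2 * b ^+ 2 = (d - c) * b ^+ 2 * (d - c) by ring.
    apply: bound_integ; [exact: ltW|exact: cont_poly|move=> y cyd].
    have [cy yd] := andP cyd.
    rewrite !hornerS -mulrA normrM ler_pM//.
      by rewrite ger0_norm ?subr_ge0// lerB.
    by rewrite normrM expr2 ler_pM//; exact: bound.
  have dS y : c <= y <= d -> `|(r^`()).[y]| <= Num.sqrt K * b / (d - c).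
    move=> cyd; have [_ H] := KE c d r y cd rk cyd.
    rewrite ler_pdivlMr// -[X in _ * X]gtr0_norm// -normrM -[leRHS]ger0_norm ?mulr_ge0
      ?sqrtr_ge0//.
    rewrite -ler_sqr ?nnegrE// !real_normK ?num_real// [leRHS]exprMn sqr_sqrtr//.
    rewrite -(ler_pM2l (_ : 0 < (d - c) ^+ 2)) ?exprn_gt0//.
    apply: le_trans (_ : K * wnorm2 c d r <= _); last first.
      by rewrite mulrCA ler_wpM2l.
    by apply: le_trans H; rewrite le_eqVlt; apply/orP; left; apply/eqP; ring.
  have := rs _ _ (size_derivW rk) dS.
  have -> : e * (d - c) * (Num.sqrt K * b / (d - c)) = e * L * (e + `|r.[d]|).
    by rewrite /L /b; field; rewrite gt_eqF.
  have I2 : integ c d (horner (r * r^`())) = 2^-1 * (r.[d] ^+ 2 - r.[c] ^+ 2).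
    rewrite (integ_poly (ltW cd) (q := 2^-1 *: (r * r))).
      by rewrite !hornerS; ring.
    have E2 : (r * r)^`() = 2%:R *: (r * r^`()).
      by rewrite derivM [_^`() * r]mulrC scaler_nat mulr2n.
    by rewrite derivZ E2 scalerA mulVf ?scale1r// pnatr_eq0.
  by rewrite I2 normrM ger0_norm ?invr_ge0//; lra.
have nn x : r.[x] ^+ 2 = `|r.[x]| ^+ 2 by rewrite real_normK ?num_real.
rewrite !nn in diff; move: diff; rewrite ler_norml => /andP[D1 D2].
have a0 : 0 <= `|r.[d]| by []; have b0 : 0 <= `|r.[c]| by [].
split.
- move=> x /bound H; apply: le_trans H _; rewrite ler_wpM2r//; lra.
- move: D1 D2 a0 b0; set a := `|r.[d]|; set b := `|r.[c]| => D1 D2 a0 b0.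
  apply: le_trans (_ : a + (2 * L + 2) * e <= _); last by rewrite lerD2l ler_wpM2r//; lra.
  rewrite -ler_sqr ?nnegrE//; last by nra.
  have H1 : 0 <= L * e * a by rewrite !mulr_ge0.
  have H2 : 0 <= L * e * e by rewrite !mulr_ge0.
  have H3 : 0 <= L * L * e * e by rewrite !mulr_ge0.
  have H4 : 0 <= a * e by rewrite mulr_ge0.
  nra.
- move: D1 D2 a0 b0; set a := `|r.[d]|; set b := `|r.[c]| => D1 D2 a0 b0.
  apply: le_trans (_ : b + (2 * L + 2) * e <= _); last by rewrite lerD2l ler_wpM2r//; lra.
  rewrite leNgt; apply/negP => ab.
  have Le : 0 <= L * e by rewrite mulr_ge0.
  have sq : b ^+ 2 < (a - (2 * L + 2) * e) ^+ 2.
    by rewrite ltr_sqr ?nnegrE//; [lra|nra].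
  have ae : (2 * L + 2) * e < a by lra.
  have H1 : (L + 2) * e * ((2 * L + 2) * e) <= (L + 2) * e * a.
    have L2 : 0 <= L + 2 by lra.
    by rewrite ler_wpM2l ?mulr_ge0//; lra.
  have H2 : 0 <= L * e * e by rewrite !mulr_ge0.
  have H3 : 0 <= e * e by rewrite mulr_ge0.
  nra.
Qed.

End CellEstimate.

(** * Integration over a mesh *)

Section Mesh.
Variables (R : realType) (a b : R) (M : mesh a b).
Hypothesis hab : a < b.
Local Notation N := (ncell M).
Local Notation x_ := (node M).
Local Notation mu := (@lebesgue_measure R).

Lemma ncell_gt0 : (0 < N)%N.
Proof.
rewrite lt0n; apply/eqP => N0; have := node_last M; rewrite N0 node_first => ab.
by move: hab; rewrite ab ltxx.
Qed.

Lemma node_le i j : (i <= j)%N -> (j <= N)%N -> x_ i <= x_ j.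
Proof.
elim: j => [|j IH]; first by rewrite leqn0 => /eqP ->.
rewrite leq_eqVlt => /predU1P[->//|ij] jN.
by apply: le_trans (IH ij (ltnW jN)) _; apply/ltW/node_incr.
Qed.

Lemma node_ge_a j : (j <= N)%N -> a <= x_ j.
Proof. by move=> jN; have := node_le (leq0n j) jN; rewrite node_first. Qed.

Lemma node_le_b j : (j <= N)%N -> x_ j <= b.
Proof. by move=> jN; have := node_le jN (leqnn N); rewrite node_last. Qed.

Lemma cell_lt (j : 'I_N) : x_ j < x_ j.+1.
Proof. exact: node_incr. Qed.

Lemma cell_sub (j : 'I_N) x : x_ j <= x <= x_ j.+1 -> a <= x <= b.
Proof.
move=> /andP[jx xj]; rewrite (le_trans (node_ge_a (ltnW (ltn_ord j))) jx).
by rewrite (le_trans xj)// node_le_b.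
Qed.

Lemma cell_size (j : 'I_N) : x_ j.+1 - x_ j <= mesh_size M.
Proof. exact: (le_bigmax _ (fun j : 'I_N => x_ j.+1 - x_ j)). Qed.

Lemma mesh_size_gt0 : 0 < mesh_size M.
Proof.
apply: lt_le_trans (cell_size (Ordinal ncell_gt0)); rewrite subr_gt0.
exact: cell_lt (Ordinal ncell_gt0).
Qed.

Lemma sum_cells : \sum_(j < N) (x_ j.+1 - x_ j) = b - a.
Proof.
rewrite -(big_mkord xpredT (fun j => x_ j.+1 - x_ j)) telescope_sumr//.
by rewrite node_first node_last.
Qed.

Definition cellint (j : 'I_N) (f : R -> R) : R := integ (x_ j) (x_ j.+1) f.

(** The right end of a cell belongs to the next cell in [glue]; as
    single points have measure zero, closed cells may be used on the right. *)
Lemma integ_cells (F : R -> R) (f : 'I_N -> R -> R) :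
  (forall j, continuous (f j)) ->
  (forall (j : 'I_N) x, x_ j <= x < x_ j.+1 -> F x = f j x) ->
  \int[lebesgue_measure]_(x in `[a, b]) F x = \sum_(j < N) cellint j (f j).
Proof.
move=> cf Ff.
pose g i : R -> R := if insub i is Some j then f j else (fun=> 0).
have gE (j : 'I_N) : g j = f j by rewrite /g valK.
have cg i : continuous (g i).
  by rewrite /g; case: insubP => [j _ _|_]; [exact: cf|exact: cont_cst].
have Fg i x : (i < N)%N -> x_ i <= x < x_ i.+1 -> F x = g i x.
  by move=> iN xi; rewrite (gE (Ordinal iN)) (Ff (Ordinal iN)).
have main n : (n <= N)%N -> mu.-integrable `[x_ 0%N, x_ n[ (EFin \o F) /\
    \int[mu]_(x in `[x_ 0%N, x_ n[) F x = \sum_(i < n) integ (x_ i) (x_ i.+1) (g i).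
  elim: n => [|n IH] nN.
    rewrite set_itvco0 big_ord0 Rintegral_set0; split => //.
    exact: integrable_set0.
  have [iF intF] := IH (ltnW nN).
  have iG : mu.-integrable `[x_ n, x_ n.+1[ (EFin \o g n).
    apply: (integrableS _ _ _ (cont_integrable (x_ n) (x_ n.+1) (cg n))) => //.
    by move=> x/=; rewrite !in_itv/= => /andP[-> /ltW ->].
  have iFn : mu.-integrable `[x_ n, x_ n.+1[ (EFin \o F).
    apply: eq_integrable iG => // x; rewrite inE/= in_itv/= => xn.
    by rewrite (Fg n).
  have U : [set` `[x_ 0%N, x_ n.+1[] = [set` `[x_ 0%N, x_ n[] `|` [set` `[x_ n, x_ n.+1[].
    by apply: itv_bndbnd_setU; rewrite bnd_simp node_le// ltnW.
  have D : disj_set [set` `[x_ 0%N, x_ n[] [set` `[x_ n, x_ n.+1[].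
    apply/disj_setPS => y [/=]; rewrite !in_itv/= => /andP[_ yn] /andP[ny _].
    by move: yn; rewrite ltNge ny.
  have iU : mu.-integrable `[x_ 0%N, x_ n.+1[ (EFin \o F).
    rewrite U; apply/integrableP.
    have [[m1 i1] [m2 i2]] := (integrableP _ _ _ iF, integrableP _ _ _ iFn).
    have mU := (measurable_funU _ (measurable_itv _) (measurable_itv _)).2 (conj m1 m2).
    split => //; rewrite ge0_integral_setU//; first exact: lte_add_pinfty.
    apply/measurable_funU => //; split.
      exact: (measurable_int _ (integrable_abse iF)).
    exact: (measurable_int _ (integrable_abse iFn)).
  split => //; rewrite big_ord_recr/= -intF U Rintegral_setU -?U//.
  congr (_ + _); rewrite /integ -Rintegral_itv_bndo_bndc//.
  by apply: eq_Rintegral => x; rewrite inE/= in_itv/=; exact: Fg.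
have [iF intF] := main _ (leqnn N).
move: iF intF; rewrite node_first node_last => iF intF.
rewrite -Rintegral_itv_bndo_bndc// intF.
by apply: eq_bigr => j _; rewrite /cellint gE.
Qed.

Lemma cell_disj (i j : 'I_N) x :
  x_ i <= x < x_ i.+1 -> x_ j <= x < x_ j.+1 -> i = j.
Proof.
move=> /andP[ix xi] /andP[jx xj]; apply/val_inj/eqP => /=.
rewrite eqn_leq; apply/andP; split; rewrite leqNgt; apply/negP => lt.
- by have := lt_le_trans xj (le_trans (node_le lt (ltnW (ltn_ord i))) ix); rewrite ltxx.
- by have := lt_le_trans xi (le_trans (node_le lt (ltnW (ltn_ord j))) jx); rewrite ltxx.
Qed.

Lemma glueE (p : 'I_N -> {poly R}) (j : 'I_N) x :
  x_ j <= x < x_ j.+1 -> Defs.glue p x = (p j).[x].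
Proof.
move=> xj; rewrite /Defs.glue (big_pred1 j)// => i; apply/idP/eqP => [xi|->//].
exact: cell_disj xi xj.
Qed.

Lemma integ_whole (f : R -> R) : continuous f ->
  integ a b f = \sum_(j < N) cellint j f.
Proof. by move=> cf; apply: integ_cells. Qed.

End Mesh.

(** * The discrete operators in terms of cell polynomials *)

Section BrokenPolynomials.
Variables (R : realType) (a b : R) (M : mesh a b) (k : nat).
Hypothesis hab : a < b.
Local Notation N := (ncell M).
Local Notation V := {ffun 'I_N -> {poly_(k.+1) R}}.
Local Notation x_ := (node M).
Implicit Types (u v w z : V) (f g : R -> R) (p : {poly R}).

Lemma size_cell v (j : 'I_N) : (size (val (v j)) <= k.+1)%N.
Proof. exact: size_npoly. Qed.

Lemma val_lin (c : R) u v (j : 'I_N) :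
  val ((c *: u + v) j) = c *: val (u j) + val (v j).
Proof. by rewrite !ffunE. Qed.

Lemma brokenE v (j : 'I_N) x : x_ j <= x < x_ j.+1 -> broken v x = (val (v j)).[x].
Proof. exact: glueE. Qed.

Lemma ip_cells f g (phi gam : 'I_N -> R -> R) :
  (forall j, continuous (phi j)) -> (forall j, continuous (gam j)) ->
  (forall (j : 'I_N) x, x_ j <= x < x_ j.+1 -> f x = phi j x) ->
  (forall (j : 'I_N) x, x_ j <= x < x_ j.+1 -> g x = gam j x) ->
  ip a b f g = \sum_(j < N) cellint j (fun x => phi j x * gam j x).
Proof.
move=> cp cg fp gg; apply: integ_cells => [j|j x xj].
  exact: contM (cp j) (cg j).
by rewrite (fp j)// (gg j).
Qed.

Lemma cellint_poly (j : 'I_N) p q :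
  cellint j (fun x => p.[x] * q.[x]) = cellint j (horner (p * q)).
Proof. by apply: eq_integ => x _; rewrite hornerM. Qed.

Lemma ipVE v w :
  ipV v w = \sum_(j < N) cellint j (horner (val (v j) * val (w j))).
Proof.
rewrite /ipV (ip_cells (phi := fun j => horner (val (v j)))
  (gam := fun j => horner (val (w j)))); [|by move=> j; exact: cont_poly..| |].
- by apply: eq_bigr => j _; exact: cellint_poly.
- by move=> j x; exact: brokenE.
- by move=> j x; exact: brokenE.
Qed.

Lemma ip_derivE w v : ip a b (broken w) (broken_deriv v) =
  \sum_(j < N) cellint j (horner (val (w j) * (val (v j))^`())).
Proof.
rewrite (ip_cells (phi := fun j => horner (val (w j)))
  (gam := fun j => horner (val (v j))^`())); [|by move=> j; exact: cont_poly..| |].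
- by apply: eq_bigr => j _; exact: cellint_poly.
- by move=> j x; exact: brokenE.
- by move=> j x; exact: glueE.
Qed.

Lemma ip_fE f v : continuous f -> ip a b f (broken v) =
  \sum_(j < N) cellint j (fun x => f x * (val (v j)).[x]).
Proof.
move=> cf; apply: ip_cells => // j; first exact: cont_poly.
by move=> x; exact: brokenE.
Qed.

Lemma meanE z : ip a b (broken z) (cst 1) = \sum_(j < N) cellint j (horner (val (z j))).
Proof.
rewrite (ip_cells (phi := fun j => horner (val (z j))) (gam := fun _ => cst 1)) //.
- by apply: eq_bigr => j _; apply: eq_integ => x _; rewrite /= mulr1.
- by move=> j; exact: cont_poly.
- by move=> j x; exact: cst_continuous.
- by move=> j x; exact: brokenE.
Qed.

Lemma mean_fE f : ip a b f (cst 1) = integ a b f.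
Proof. by apply: eq_integ => x _; rewrite /= mulr1. Qed.

Lemma cellintD (j : 'I_N) f g : continuous f -> continuous g ->
  cellint j (fun x => f x + g x) = cellint j f + cellint j g.
Proof. exact: integD. Qed.

Lemma cellintZ (j : 'I_N) c f : continuous f ->
  cellint j (fun x => c * f x) = c * cellint j f.
Proof. exact: integZ. Qed.

Lemma cellint_lin (j : 'I_N) (c : R) f g : continuous f -> continuous g ->
  cellint j (fun x => c * f x + g x) = c * cellint j f + cellint j g.
Proof.
by move=> cf cg; rewrite cellintD// ?cellintZ//; apply: contM => //; exact: cont_cst.
Qed.

Lemma cellint_plin (j : 'I_N) (c : R) p q :
  cellint j (horner (c *: p + q)) = c * cellint j (horner p) + cellint j (horner q).
Proof.
rewrite -cellint_lin; [|exact: cont_poly..].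
by apply: eq_integ => x _; rewrite !hornerS.
Qed.

Lemma ipV_lin (c : R) u v w : ipV (c *: u + v) w = c * ipV u w + ipV v w.
Proof.
rewrite !ipVE mulr_sumr -big_split; apply: eq_bigr => j _ /=.
by rewrite val_lin mulrDl -scalerAl cellint_plin.
Qed.

Lemma ipV_sym u v : ipV u v = ipV v u.
Proof. by rewrite !ipVE; apply: eq_bigr => j _; rewrite mulrC. Qed.

Lemma ipV_pos u : u != 0 -> 0 < ipV u u.
Proof.
have ge j : 0 <= cellint j (horner (val (u j) * val (u j))).
  by apply: integ_ge0 => x _; rewrite hornerM -expr2 sqr_ge0.
move=> u0; rewrite lt_neqAle ipVE sumr_ge0 ?andbT// eq_sym.
apply: contra u0; rewrite psumr_eq0// => /allP E; apply/eqP/ffunP => j.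
have /E/eqP/(poly_nonneg_integ0 (cell_lt j)) H : j \in index_enum 'I_N by rewrite
  mem_index_enum.
apply/val_inj; rewrite ffunE /=; apply/eqP.
have /eqP : val (u j) * val (u j) = 0.
  by apply: H => x _; rewrite hornerM -expr2 sqr_ge0.
by rewrite mulf_eq0 orbb.
Qed.

Definition ipV_eq := form_eq ipV_lin ipV_pos.

Lemma L2proj_spec f v : continuous f -> ipV (L2proj M k f) v = ip a b f (broken v).
Proof.
move=> cf; have [r rE] : exists r : V, forall v, ipV r v = ip a b f (broken v).
  apply: (riesz ipV_lin ipV_sym ipV_pos) => c u w.
  rewrite !ip_fE// mulr_sumr -big_split; apply: eq_bigr => j _ /=.
  rewrite -cellint_lin; [|by apply: contM => //; exact: cont_poly..].
  by apply: eq_integ => x _; rewrite val_lin !hornerS; ring.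
have := @xgetI _ 0 [set p : V | forall v, ipV p v = ip a b f (broken v)] r rE.
by apply.
Qed.

Lemma trace_left_lin (c : R) u v j :
  trace_left (c *: u + v) j = c * trace_left u j + trace_left v j.
Proof. by rewrite /trace_left val_lin !hornerS. Qed.

Lemma trace_right_lin (c : R) u v j :
  trace_right (c *: u + v) j = c * trace_right u j + trace_right v j.
Proof. by rewrite /trace_right val_lin !hornerS. Qed.

Lemma Dop_spec (theta : R) w v : ipV (Dop M k theta w) v =
  - ip a b (broken w) (broken_deriv v) - \sum_(j < N) flux theta w j * jump v j.
Proof.
have [D DE] : exists D : 'End(V), forall w v, ipV (D w) v =
    - ip a b (broken w) (broken_deriv v) - \sum_(j < N) flux theta w j * jump v j.
  apply: (operator_of_form ipV_lin ipV_sym ipV_pos) => c u z y.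
  - rewrite !ip_derivE -!opprD mulrN mulrDr !mulr_sumr -opprD; congr (- _).
    rewrite -!big_split /=; apply: eq_bigr => j _.
    rewrite val_lin mulrDl -scalerAl cellint_plin /flux trace_left_lin trace_right_lin.
    ring.
  - rewrite !ip_derivE -!opprD mulrN mulrDr !mulr_sumr -opprD; congr (- _).
    rewrite -!big_split /=; apply: eq_bigr => j _.
    rewrite val_lin derivD derivZ mulrDr -scalerAr cellint_plin /jump.
    rewrite trace_left_lin trace_right_lin; ring.
have := @xgetI _ 0 [set D : 'End(V) | forall w v : V, ipV (D w) v =
  - ip a b (broken w) (broken_deriv v) - \sum_(j < N) flux theta w j * jump v j] D DE.
by apply.
Qed.

Lemma adjoint_unique (A B : 'End(V)) :
  (forall v w, ipV (B v) w = ipV v (A w)) -> adjoint A = B.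
Proof.
move=> BE; have := @xgetI _ 0 [set B : 'End(V) | forall v w : V,
  ipV (B v) w = ipV v (A w)] B BE.
move=> H; apply/lfunP => v; apply: ipV_eq => w.
by rewrite BE; exact: H.
Qed.

(** Supported on one cell, so that testing with it localizes identities
    between integrals. *)
Definition cell_fun (i : 'I_N) p : V :=
  [ffun j => if j == i then npolyp k.+1 p else 0].

Lemma cell_funE (i j : 'I_N) p : (size p <= k.+1)%N ->
  val (cell_fun i p j) = if j == i then p else 0.
Proof. by move=> pk; rewrite ffunE; case: ifP => // _; exact: npolypK. Qed.

Lemma cellint0 (j : 'I_N) : cellint j (horner (0 : {poly R})) = 0.
Proof. by have := cellint_plin j (-1) 0 0; rewrite scaler0 addr0 mulN1r addNr. Qed.

Lemma ipV_cell v (i : 'I_N) p : (size p <= k.+1)%N ->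
  ipV v (cell_fun i p) = cellint i (horner (val (v i) * p)).
Proof.
move=> pk; rewrite ipVE (bigD1 i)//= cell_funE// eqxx big1 ?addr0// => j ji.
by rewrite cell_funE// (negPf ji) mulr0 cellint0.
Qed.

(** The defining identity of [Dop] tested with a function supported on
    one cell; only the fluxes at its two ends remain. *)
Lemma Dop_local (theta : R) z (i : 'I_N) p : (size p <= k.+1)%N ->
  cellint i (horner (val (Dop M k theta z i) * p)) =
  - cellint i (horner (val (z i) * p^`())) + flux theta z i * p.[x_ i.+1]
  - flux theta z (ord_pred i) * p.[x_ i].
Proof.
move=> pk; rewrite -(ipV_cell (Dop M k theta z) i pk) Dop_spec ip_derivE.
rewrite (bigD1 i)//= cell_funE// eqxx big1 ?addr0; last first.
  by move=> j ji; rewrite cell_funE// (negPf ji) deriv0 mulr0 cellint0.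
rewrite -addrA; congr (_ + _).
under eq_bigr do rewrite /jump mulrBr; rewrite sumrB opprB; congr (_ - _).
- rewrite (bigD1 i)//= /trace_left cell_funE// eqxx big1 ?addr0// => j ji.
  by rewrite cell_funE// (negPf ji) horner0 mulr0.
- rewrite (bigD1 (ord_pred i))//= /trace_right ord_predK cell_funE// eqxx.
  rewrite big1 ?addr0// => j ji; rewrite cell_funE// ifN ?horner0 ?mulr0//.
  by apply: contra ji => /eqP <-; rewrite ordSK.
Qed.

End BrokenPolynomials.

(** * Polynomial approximation and the L2 projection *)

Section Approximation.
Variable R : realType.
Implicit Types (c d x y W A : R) (g f : R -> R).

Lemma mvt_bound c d A f g : c <= d -> (forall x, is_derive x 1 f (g x)) ->
  (forall x, c <= x <= d -> `|g x| <= A) ->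
  forall x, c <= x <= d -> `|f x - f c| <= A * (x - c).
Proof.
move=> cd df gA x /andP[]; rewrite le_eqVlt => /predU1P[<-|cx] xd.
  by rewrite !subrr normr0 mulr0.
have cf : {within `[c, x], continuous f}.
  by apply: continuous_subspaceT => z; exact: is_derive_cont (df z).
have [y /[!in_itv]/= /andP[cy yx] ->] := MVT cx (fun y _ => df y) cf.
rewrite normrM [`|x - c|]gtr0_norm ?subr_gt0// ler_wpM2r ?subr_ge0 ?(ltW cx)//.
by apply: gA; rewrite (ltW cy) (le_trans (ltW yx)).
Qed.

(** Integrate the approximant of the derivative, with the exact value at
    the left end. *)
Lemma taylor_approx n (g : nat -> R -> R) c d W : c <= d ->
  (forall i, (i < n)%N -> forall x, is_derive x 1 (g i) (g i.+1 x)) ->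
  (forall x, c <= x <= d -> `|g n x| <= W) ->
  exists2 p : {poly R}, (size p <= n)%N &
    forall x, c <= x <= d -> `|g 0%N x - p.[x]| <= W * (d - c) ^+ n.
Proof.
move=> cd; have dc : 0 <= d - c by rewrite subr_ge0.
elim: n g => [|n IH] g dg gW.
  exists 0; first by rewrite size_poly0.
  by move=> x /gW; rewrite horner0 subr0 expr0 mulr1.
have [//|p pn pE] := IH (fun i => g i.+1) _ gW.
  by move=> i ni x; exact: dg.
exists (prim p + (g 0%N c - (prim p).[c])%:P).
  rewrite (leq_trans (size_polyD _ _))// geq_max (leq_trans (size_prim _))//=.
  by rewrite (leq_trans (size_polyC_leq1 _)).
move=> x cxd; set q := prim p + _.
have q' : q^`() = p by rewrite derivD derivC addr0 primK.
have dq y : is_derive y 1 (fun x => g 0%N x - q.[x]) (g 1%N y - p.[y]).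
  apply: is_deriveB; first exact: dg.
  by rewrite -q'; exact: is_derive_poly.
have := mvt_bound cd dq pE cxd.
have -> : g 0%N c - q.[c] = 0 by rewrite /q !hornerS; ring.
rewrite subr0 => /le_trans; apply; rewrite exprSr mulrA.
have [cx xd] := andP cxd.
have W0 : 0 <= W by apply: le_trans (gW x cxd).
by rewrite ler_wpM2l ?mulr_ge0 ?exprn_ge0// lerB.
Qed.

(** At an index where [al] is largest, the relation carrying the larger
    of the two weights bounds that maximum by the smaller weight times
    itself, up to [T] and [D]. *)
Lemma cyclic_bound n (t1 t2 T D : R) (al be : 'I_n -> R) :
  0 <= t1 -> 0 <= t2 -> 0 <= D ->
  (forall j, t1 * al j <= t2 * be (ordS j) + T) ->
  (forall j, t2 * be (ordS j) <= t1 * al j + T) ->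
  (forall j, be j <= al j + D) -> (forall j, al j <= be j + D) ->
  forall j, `|t1 - t2| * al j <= T + (t1 + t2) * D.
Proof.
move=> t10 t20 D0 H1 H2 H3 H4 j0.
case: (@Order.TotalTheory.arg_maxP _ _ _ j0 xpredT al isT) => j _ jmax.
apply: (@le_trans _ _ (`|t1 - t2| * al j)).
  by rewrite ler_wpM2l//; exact: jmax.
have [t12|/ltW t21] := leP t1 t2.
- rewrite distrC ger0_norm ?subr_ge0//.
  have := H2 (ord_pred j); rewrite ord_predK => E1.
  have E2 := ler_wpM2l t20 (H4 j).
  have E3 := ler_wpM2l t10 (jmax (ord_pred j) isT).
  have E4 : 0 <= t1 * D by rewrite mulr_ge0.
  lra.
- rewrite ger0_norm ?subr_ge0//.
  have E1 := H1 j.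
  have E2 := ler_wpM2l t20 (H3 (ordS j)).
  have E3 := ler_wpM2l t20 (jmax (ordS j) isT).
  have E4 : 0 <= t1 * D by rewrite mulr_ge0.
  lra.
Qed.

End Approximation.

Section SpaceError.
Variables (R : realType) (a b : R) (k : nat).
Hypothesis hab : a < b.

Definition approx (M : mesh a b) (w : R -> R) (e : R) :=
  forall j : 'I_(ncell M), exists2 p : {poly R}, (size p <= k.+1)%N &
    forall x, node M j <= x <= node M j.+1 -> `|w x - p.[x]| <= e.

Definition close (M : mesh a b) (z : Vh M k) (w : R -> R) (e : R) :=
  forall (j : 'I_(ncell M)) x, node M j <= x <= node M j.+1 ->
    `|(val (z j)).[x] - w x| <= e.

Lemma approx_ge0 (M : mesh a b) w e : approx M w e -> 0 <= e.
Proof.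
pose j := Ordinal (ncell_gt0 M hab).
move=> /(_ j)[p _ pE]; apply: le_trans (pE (node M j) _); first exact: normr_ge0.
by rewrite lexx ltW// cell_lt.
Qed.

Lemma smooth_approx (M : mesh a b) (g : nat -> R -> R) (W : R) :
  (forall i, (i <= k)%N -> forall x : R, is_derive x 1 (g i) (g i.+1 x)) ->
  (forall x, a <= x <= b -> `|g k.+1 x| <= W) ->
  approx M (g 0%N) (W * mesh_size M ^+ k.+1).
Proof.
move=> dg gW j.
have [|p pk pE] := @taylor_approx R k.+1 g (node M j) (node M j.+1) W (ltW (cell_lt j)) dg.
  by move=> x /cell_sub; exact: gW.
exists p => // x xj; apply: le_trans (pE x xj) _.
have W0 : 0 <= W.
  by apply: le_trans (gW a _) => //; rewrite lexx ltW.
rewrite ler_wpM2l// lerXn2r// ?nnegrE ?subr_ge0 ?(ltW (cell_lt j)) ?cell_size//.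
by rewrite ltW// mesh_size_gt0.
Qed.

(** Compare with an arbitrary approximant [p]: the difference [r] is
    itself a test function, so its squared L2 norm is at most [e] times the
    cell length times its maximum, and the inverse inequality concludes. *)
Lemma L2proj_error : exists2 C, 0 <= C & forall (M : mesh a b) w e,
  continuous w -> approx M w e -> close (L2proj M k w) w (C * e).
Proof.
have [K K0 KE] := inverse_cell R k.+1; exists (K + 1); first by rewrite addr_ge0.
move=> M w e cw wa j x xj; have e0 := approx_ge0 wa.
have [p pk pE] := wa j.
set z := L2proj M k w; pose r := val (z j) - p.
have rk : (size r <= k.+1)%N.
  by rewrite (leq_trans (size_polyD _ _))// geq_max size_polyN pk andbT size_cell.
pose c := node M j; pose d := node M j.+1.
have cd : c < d by exact: cell_lt.
have dc : 0 < d - c by rewrite subr_gt0.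
pose I := cellint j (horner (r * r)).
have I0 : 0 <= I by apply: integ_ge0 => y _; rewrite hornerM -expr2 sqr_ge0.
pose S := Num.sqrt (K * (d - c) * I) / (d - c).
have KI : 0 <= K * (d - c) * I by rewrite !mulr_ge0// ltW.
have S0 : 0 <= S by rewrite divr_ge0 ?sqrtr_ge0 ?ltW.
have wI : wnorm2 c d r <= (d - c) * I.
  rewrite /I /cellint -integZ; last exact: cont_poly.
  apply: le_integ; [exact: cont_poly|by apply: contM; [exact: cont_cst|exact: cont_poly]|].
  move=> y /andP[cy yd]; rewrite !hornerS -mulrA -expr2 ler_wpM2r ?sqr_ge0// lerB//.
have rS y : c <= y <= d -> `|r.[y]| <= S.
  move=> cyd; have [H _] := KE c d r y cd rk cyd.
  rewrite ler_pdivlMr// -[X in _ * X]gtr0_norm// -normrM -[leRHS]ger0_norm ?sqrtr_ge0//.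
  rewrite -ler_sqr ?nnegrE// !real_normK ?num_real// sqr_sqrtr// mulrC.
  by apply: le_trans H _; rewrite -mulrA ler_wpM2l.
have IE : I = cellint j (fun y => (w y - p.[y]) * r.[y]).
  have E1 : cellint j (horner (val (z j) * r)) = cellint j (fun y => w y * r.[y]).
    rewrite -(ipV_cell z j rk) L2proj_spec// ip_fE// (bigD1 j)//= big1 ?addr0.
      by apply: eq_integ => y _; rewrite cell_funE// eqxx.
    move=> i ij; rewrite cell_funE// (negPf ij) -[RHS](cellint0 i).
    by apply: eq_integ => y _; rewrite horner0 mulr0.
  transitivity (cellint j (horner (val (z j) * r)) - cellint j (horner (p * r))).
    rewrite -[RHS]integB; [|exact: cont_poly..].
    by apply: eq_integ => y _; rewrite /r !hornerS; ring.
  rewrite E1 -[LHS]integB; [|by apply: contM => //; exact: cont_poly|exact: cont_poly].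
  by apply: eq_integ => y _; rewrite !hornerS; ring.
have IS : I <= e * S * (d - c).
  rewrite IE; apply: le_trans (ler_norm _) _; apply: bound_integ; first exact: ltW.
    by apply: contM; [apply: contB => //; exact: cont_poly|exact: cont_poly].
  by move=> y cyd; rewrite normrM ler_pM//; [exact: pE|exact: rS].
have SK : S <= K * e.
  have [->|Sn0] := eqVneq S 0; first by rewrite mulr_ge0.
  have Sp : 0 < S by rewrite lt_neqAle eq_sym Sn0.
  rewrite -(ler_pM2r Sp) -(ler_pM2r (_ : 0 < (d - c) ^+ 2)) ?exprn_gt0//.
  have -> : S * S * (d - c) ^+ 2 = K * (d - c) * I.
    by rewrite -expr2 /S expr_div_n sqr_sqrtr// divfK// expf_eq0/= gt_eqF.
  apply: le_trans (_ : K * (d - c) * (e * S * (d - c)) <= _).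
    by rewrite ler_wpM2l// mulr_ge0// ltW.
  by rewrite le_eqVlt; apply/orP; left; apply/eqP; ring.
have -> : (val (z j)).[x] - w x = r.[x] - (w x - p.[x]) by rewrite /r !hornerS; ring.
apply: le_trans (ler_normB _ _) _; rewrite mulrDl mul1r lerD//; last exact: pE.
exact: le_trans (rS x xj) SK.
Qed.

End SpaceError.

(** * Recovering a function from its discrete derivative *)

Section DopError.
Variables (R : realType) (a b : R) (k : nat).
Hypothesis hab : a < b.
Implicit Types (M : mesh a b).

(** Take the antiderivative of [Dop theta z] with the flux of [z] as
    left end value.  Testing with the constant 1 gives the right end value;
    testing with an antiderivative of [s] gives the orthogonality. *)
Lemma flux_antiderivative M (theta : R) (z : Vh M k) :
  exists F : 'I_(ncell M) -> {poly R}, forall j,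
    [/\ (F j)^`() = val (Dop M k theta z j),
        (F j).[node M j] = flux theta z (ord_pred j),
        (F j).[node M j.+1] = flux theta z j &
        forall s : {poly R}, (size s <= k)%N ->
          cellint j (horner (val (z j) * s)) = cellint j (horner (F j * s))].
Proof.
pose G j := prim (val (Dop M k theta z j)).
pose F j := G j + (flux theta z (ord_pred j) - (G j).[node M j])%:P.
exists F => j.
have F' : (F j)^`() = val (Dop M k theta z j) by rewrite derivD derivC addr0 primK.
have Fl : (F j).[node M j] = flux theta z (ord_pred j) by rewrite /F !hornerS; ring.
have Fr : (F j).[node M j.+1] = flux theta z j.
  have := Dop_local theta z j (leq_trans (size_polyC_leq1 1) (ltn0Sn k)).
  rewrite mulr1 derivC mulr0 cellint0 !hornerC !mulr1 oppr0 add0r.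
  rewrite /cellint (integ_poly (ltW (cell_lt j)) F') Fl => /addIr; exact.
split => // s sk.
have sk1 : (size (prim s) <= k.+1)%N by exact: leq_trans (size_prim s) _.
have := Dop_local theta z j sk1; rewrite primK -Fl -Fr.
have FP : (F j * prim s)^`() = val (Dop M k theta z j) * prim s + F j * s.
  by rewrite derivM F' primK.
have := integ_poly (ltW (cell_lt j)) FP; rewrite -[X in horner (X + _)]scale1r.
rewrite -/(cellint j _) cellint_plin mul1r !hornerM => E1 E2.
apply/eqP; rewrite -subr_eq0; apply/eqP.
move: E1 E2; set A := cellint _ _; set B := cellint _ _; set C := cellint _ _ => E1 E2.
have -> : C - B = A + B - A - (B + B) + C by ring.
rewrite E1 E2; lra.
Qed.

(** The antiderivative [F] of [Dop theta z] differs from [w] by a constant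
    [d] up to [A (b - a)], so [z - d] minus a polynomial approximant of [w]
    satisfies [cell_estimate] on each cell, and the flux identities
    give the hypotheses of [cyclic_bound].  The equality of the means
    finally bounds [d]. *)
Lemma Dop_error (theta : R) : theta != 1 / 2 -> exists2 C, 0 <= C &
  forall M (z : Vh M k) (w w' : R -> R) (A e : R),
    0 <= A -> (forall x : R, is_derive x 1 w (w' x)) -> close (Dop M k theta z) w' A ->
    approx k M w e -> ip a b (broken z) (cst 1) = ip a b w (cst 1) ->
    close z w (C * (A + e)).
Proof.
move=> th; have [K K0 KE] := cell_estimate R k.
pose t1 := `|theta|; pose t2 := `|1 - theta|.
have t10 : 0 <= t1 by exact: normr_ge0.
have t20 : 0 <= t2 by exact: normr_ge0.
have t12 : 0 < `|t1 - t2|.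
  rewrite normr_gt0 subr_eq0; apply: contra th => /eqP E.
  have : t1 ^+ 2 = t2 ^+ 2 by rewrite E.
  rewrite /t1 /t2 !real_normK ?num_real// => E2; apply/eqP; lra.
pose C2 := (t1 + t2) * (1 + K) / `|t1 - t2|.
have C20 : 0 <= C2 by rewrite divr_ge0// ?mulr_ge0 ?addr_ge0// ltW.
pose C3 := K * (1 + C2) + 1.
have C30 : 0 <= C3 by rewrite addr_ge0// mulr_ge0// addr_ge0.
have ba : 0 < b - a by rewrite subr_gt0.
exists (2 * C3 * (b - a + 1)); first by rewrite !mulr_ge0// addr_ge0// ltW.
move=> M z w w' A e A0 dw DzA wa mean.
have e0 := approx_ge0 hab wa.
have cw : continuous w by move=> x; exact: is_derive_cont (dw x).
have [F FE] := flux_antiderivative theta z.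
(* The constant by which F and w differ is read off at the left end. *)
pose j0 : 'I_(ncell M) := Ordinal (ncell_gt0 M hab).
pose d := (F j0).[a] - w a.
have dF j (x : R) : is_derive x 1 (fun y => (F j).[y] - w y) (((F j)^`()).[x] - w' x).
  by apply: is_deriveB; exact: is_derive_poly.
(* F - w - d vanishes at a and its slope is at most A in modulus, so the
   bound propagates from cell to cell. *)
have step (j : 'I_(ncell M)) :
    `|(F j).[node M j] - w (node M j) - d| <= A * (node M j - a) ->
    forall x, node M j <= x <= node M j.+1 -> `|(F j).[x] - w x - d| <= A * (x - a).
  move=> H x xj.
  have H2 : `|(F j).[x] - w x - ((F j).[node M j] - w (node M j))| <= A * (x - node M j).
    apply: (mvt_bound (ltW (cell_lt j)) (dF j) _ xj) => y yj.
    by case: (FE j) => -> _ _ _; exact: DzA.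
  have -> : (F j).[x] - w x - d = ((F j).[x] - w x - ((F j).[node M j] - w (node M j)))
    + ((F j).[node M j] - w (node M j) - d) by ring.
  apply: le_trans (ler_normD _ _) _; have := lerD H2 H.
  by rewrite -mulrDr; have -> : x - node M j + (node M j - a) = x - a by ring.
have Fw n (j : 'I_(ncell M)) : val j = n -> forall x, node M j <= x <= node M j.+1 ->
    `|(F j).[x] - w x - d| <= A * (x - a).
  elim: n j => [|n IH] j jn; apply: step.
  - have -> : j = j0 by apply: val_inj.
    by rewrite /= node_first /d !subrr mulr0 normr0.
  - have nN : (n < ncell M)%N by apply: ltnW; rewrite -jn ltn_ord.
    have E : ord_pred j = Ordinal nN.
      by apply: val_inj => /=; rewrite jn /= modnDr modn_small.
    have [_ -> _ _] := FE j; rewrite E; have [_ _ <- _] := FE (Ordinal nN).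
    rewrite jn; apply: (IH (Ordinal nN)) => //=.
    by rewrite lexx andbT ltW// (cell_lt (Ordinal nN)).
pose E := A * (b - a) + e.
have E0 : 0 <= E by rewrite addr_ge0// mulr_ge0// ltW.
have Fb (j : 'I_(ncell M)) x : node M j <= x <= node M j.+1 ->
  `|(F j).[x] - w x - d| <= A * (b - a).
  move=> xj; apply: le_trans (Fw j j erefl x xj) _; rewrite ler_wpM2l// lerB//.
  by case/andP: (cell_sub xj).
have /boolp.choice[p pE] : forall j : 'I_(ncell M), exists p : {poly R}, (size p <= k.+1)%N /\
    forall x, node M j <= x <= node M j.+1 -> `|w x - p.[x]| <= e.
  by move=> j; case: (wa j) => p; exists p.
have Fp (j : 'I_(ncell M)) x : node M j <= x <= node M j.+1 ->
  `|(F j).[x] - (p j).[x] - d| <= E.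
  move=> xj; have [_ /(_ x xj) H] := pE j.
  have -> : (F j).[x] - (p j).[x] - d = ((F j).[x] - w x - d) + (w x - (p j).[x]) by ring.
  by apply: le_trans (ler_normD _ _) _; rewrite lerD// Fb.
pose r j := val (z j) - p j - d%:P.
have rk j : (size (r j) <= k.+1)%N.
  rewrite (leq_trans (size_polyD _ _))// geq_max size_polyN (leq_trans (size_polyC_leq1
    _))// andbT.
  by rewrite (leq_trans (size_polyD _ _))// geq_max size_polyN size_cell; case: (pE j).
have rs (j : 'I_(ncell M)) (s : {poly R}) (S : R) : (size s <= k)%N ->
    (forall x, node M j <= x <= node M j.+1 -> `|s.[x]| <= S) ->
    `|cellint j (horner (r j * s))| <= E * (node M j.+1 - node M j) * S.
  move=> sk sS.
  have -> : cellint j (horner (r j * s)) = cellint j (horner ((F j - p j - d%:P) * s)).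
    have [_ _ _ /(_ s sk) H] := FE j.
    have split_r (q : {poly R}) : (q - p j - d%:P) * s = 1 *: (q * s) + (- (p j + d%:P) * s).
      by rewrite scale1r; ring.
    by rewrite /r !split_r !cellint_plin H.
  rewrite mulrAC; apply: bound_integ; [exact/ltW/cell_lt|exact: cont_poly|].
  move=> x xj; rewrite hornerM normrM ler_pM//; last exact: sS.
  by rewrite !hornerS; exact: Fp.
have est j := KE _ _ (r j) E (cell_lt j) (rk j) E0 (rs j).
pose al j := `|(r j).[node M j.+1]|; pose be j := `|(r j).[node M j]|.
have rel j : `|theta * (r j).[node M j.+1] + (1 - theta) * (r (ordS j)).[node M (ordS j)]|
  <= (t1 + t2) * E.
  have [_ _ F1 _] := FE j; have [_ F2 _ _] := FE (ordS j); rewrite ordSK in F2.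
  have -> : theta * (r j).[node M j.+1] + (1 - theta) * (r (ordS j)).[node M (ordS j)]
    = theta * ((F j).[node M j.+1] - (p j).[node M j.+1] - d)
    + (1 - theta) * ((F (ordS j)).[node M (ordS j)] - (p (ordS j)).[node M (ordS j)] - d).
    rewrite F1 F2 /r !hornerS /flux /trace_left /trace_right; ring.
  apply: le_trans (ler_normD _ _) _; rewrite !normrM mulrDl lerD// ler_wpM2l//; apply: Fp.
    by rewrite lexx ltW// cell_lt.
  by rewrite lexx ltW// cell_lt.
have KE0 : 0 <= K * E by rewrite mulr_ge0.
have cyc := @cyclic_bound R (ncell M) t1 t2 ((t1 + t2) * E) (K * E) al be t10 t20 KE0.
have al_le j : al j <= C2 * E.
  have -> : C2 * E = ((t1 + t2) * E + (t1 + t2) * (K * E)) / `|t1 - t2|.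
    by rewrite /C2; ring.
  rewrite ler_pdivlMr// mulrC; apply: cyc => {}j.
  - rewrite /al /be /t1 /t2 -!normrM -lerBlDl; apply: le_trans (rel j).
    by rewrite -[X in _ - X]normrN; apply: le_trans (lerB_dist _ _) _; rewrite opprK.
  - rewrite /al /be /t1 /t2 -!normrM -lerBlDl; apply: le_trans (rel j).
    by rewrite -[X in _ - X]normrN; apply: le_trans (lerB_dist _ _) _; rewrite opprK addrC.
  - by case: (est j).
  - by case: (est j).
have zw (j : 'I_(ncell M)) x : node M j <= x <= node M j.+1 ->
  `|(val (z j)).[x] - w x - d| <= C3 * E.
  move=> xj; have [_ /(_ x xj) H] := pE j.
  have -> : (val (z j)).[x] - w x - d = (r j).[x] - (w x - (p j).[x]) by rewrite /r
    !hornerS; ring.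
  apply: le_trans (ler_normB _ _) _; rewrite [leRHS]mulrDl mul1r lerD//.
    have [/(_ x xj) H1 _ _] := est j; apply: le_trans H1 _; rewrite -mulrA ler_wpM2l//.
    by rewrite mulrDl mul1r lerD2l al_le.
  by apply: le_trans H _; rewrite lerDr mulr_ge0// ltW.
have dE : `|d| <= C3 * E.
  have I1 : \sum_(j < ncell M) cellint j (fun x => (val (z j)).[x] - w x - d) = - d * (b - a).
    have : ip a b (broken z) (cst 1) - ip a b w (cst 1) = 0 by rewrite mean subrr.
    rewrite meanE mean_fE (integ_whole M)// -sumrB => I0.
    rewrite -[LHS]subr0 -[X in _ - X]I0 -sumrB -(sum_cells M) mulr_sumr.
    apply: eq_bigr => j _; rewrite mulNr -integ_cst ?(ltW (cell_lt j))//.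
    have cz := @cont_poly R (val (z j)).
    have czw := contB cz cw; have cd := @cont_cst R d.
    rewrite /cellint (integB _ _ czw cd) (integB _ _ cz cw); ring.
  rewrite -(ler_pM2r ba) -[X in _ * X](gtr0_norm ba) -normrM -normrN -mulNr -I1.
  apply: le_trans (ler_norm_sum _ _ _) _; rewrite -(sum_cells M) mulr_sumr.
  apply: ler_sum => j _; apply: bound_integ; [exact/ltW/cell_lt| |exact: zw].
  by apply: contB; [apply: contB => //; exact: cont_poly|exact: cont_cst].
move=> j x xj.
have -> : (val (z j)).[x] - w x = ((val (z j)).[x] - w x - d) + d by ring.
apply: le_trans (ler_normD _ _) _; apply: le_trans (lerD (zw j x xj) dE) _.
have EE : E <= (b - a + 1) * (A + e).
  have H1 : 0 <= e * (b - a) by rewrite mulr_ge0// ltW.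
  rewrite /E; lra.
have -> : C3 * E + C3 * E = 2 * C3 * E by ring.
by rewrite -[leRHS]mulrA ler_wpM2l// mulr_ge0.
Qed.

End DopError.

(** * Norms, adjoints and inverses *)

Section Norms.
Variables (R : realType) (a b : R) (k : nat) (M : mesh a b).
Hypothesis hab : a < b.
Local Notation N := (ncell M).
Local Notation V := {ffun 'I_N -> {poly_(k.+1) R}}.
Implicit Types (u v w z : V).

Lemma normV_ge0 v : 0 <= normV v.
Proof. exact: sqrtr_ge0. Qed.

Lemma normV_sqr v : normV v ^+ 2 = ipV v v.
Proof. by rewrite sqr_sqrtr//; exact: (form_ge0 (@ipV_lin _ _ _ M k) (@ipV_pos _ _ _ M k)). Qed.

Lemma normV_eq0 v : normV v = 0 -> v = 0.
Proof.
move=> v0; apply/eqP; apply: contraT => /ipV_pos.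
by rewrite -normV_sqr v0 expr0n ltxx.
Qed.

Lemma ipV_CS u v : ipV u v <= normV u * normV v.
Proof.
have := form_CS (@ipV_lin _ _ _ M k) (@ipV_sym _ _ _ M k) (@ipV_pos _ _ _ M k) u v.
rewrite -!normV_sqr -exprMn => H; apply: le_trans (ler_norm _) _.
by rewrite -ler_sqr ?nnegrE ?mulr_ge0 ?normV_ge0// real_normK ?num_real.
Qed.

Lemma normVD u v : normV (u + v) <= normV u + normV v.
Proof.
rewrite -ler_sqr ?nnegrE ?addr_ge0 ?normV_ge0// normV_sqr sqrrD !normV_sqr.
have lin := @ipV_lin _ _ _ M k.
rewrite (formDl lin) ipV_sym (formDl lin) (ipV_sym v (u + v)) (formDl lin) (ipV_sym v u).
have := ipV_CS u v; rewrite (mulr2n (normV u * normV v)); lra.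
Qed.

Lemma normVZ (c : R) v : normV (c *: v) = `|c| * normV v.
Proof.
apply/eqP; rewrite -(@eqrXn2 _ 2)// ?mulr_ge0 ?normV_ge0//.
have lin := @ipV_lin _ _ _ M k.
rewrite exprMn !normV_sqr (formZl lin) ipV_sym (formZl lin) real_normK ?num_real//.
by rewrite expr2 mulrA.
Qed.

Lemma normV0 : normV (0 : V) = 0.
Proof. by rewrite -(scale0r 0) normVZ normr0 mul0r. Qed.

Lemma normV_sum (n : nat) (f : 'I_n -> V) : normV (\sum_i f i) <= \sum_i normV (f i).
Proof.
elim/big_ind2: _ => [|u x v y ux vy|//]; first by rewrite normV0.
exact: le_trans (normVD _ _) (lerD ux vy).
Qed.

Lemma normV_bound v (A : R) : 0 <= A -> close v (fun=> 0) A ->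
  normV v <= Num.sqrt (b - a) * A.
Proof.
move=> A0 vA; have ba : 0 <= b - a by rewrite subr_ge0 ltW.
rewrite -ler_sqr ?nnegrE ?mulr_ge0 ?normV_ge0 ?sqrtr_ge0// normV_sqr exprMn sqr_sqrtr//.
rewrite ipVE mulrC -(sum_cells M) mulr_sumr; apply: ler_sum => j _.
apply: le_trans (ler_norm _) _; apply: bound_integ; [exact/ltW/cell_lt|exact: cont_poly|].
move=> x xj; rewrite hornerM normrM expr2; have := vA j x xj; rewrite subr0 => H.
by rewrite ler_pM.
Qed.

(** The supremum defining [opnorm] is over a bounded set because the
    coordinates in a basis are bounded functionals. *)
Lemma opnorm_bound (A : 'End(V)) v : normV (A v) <= opnorm A * normV v.
Proof.
have [C C0 CE] : exists2 C, 0 <= C & forall v, normV (A v) <= C * normV v.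
  pose e := vbasis (fullv : {vspace V}).
  have /boolp.choice[K KE] : forall i, exists K, 0 <= K /\ forall v,
    `|coord e i v| <= K * normV v.
    move=> i; have [x u w|K K0 KE] := functional_bound (@ipV_lin _ _ _ M k) (@ipV_sym _ _ _ M k)
        (@ipV_pos _ _ _ M k) (phi := coord e i).
      by rewrite linearP.
    exists (Num.sqrt K); split=> [|w]; first exact: sqrtr_ge0.
    rewrite -ler_sqr ?nnegrE ?mulr_ge0 ?sqrtr_ge0 ?normV_ge0//.
    by rewrite real_normK ?num_real// exprMn sqr_sqrtr// normV_sqr.
  exists (\sum_i K i * normV (A e`_i)).
    by apply: sumr_ge0 => i _; rewrite mulr_ge0 ?normV_ge0//; case: (KE i).
  move=> w; rewrite {1}(coord_vbasis (memvf w)) linear_sum mulr_suml.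
  apply: le_trans (normV_sum _) _; apply: ler_sum => i _.
  rewrite linearZ /= normVZ mulrAC ler_wpM2r ?normV_ge0//.
  by case: (KE i).
have ub : has_ubound [set normV (A v) | v in [set v : V | normV v <= 1]].
  exists C => _ [w /= w1 <-]; apply: le_trans (CE w) _.
  by rewrite -[leRHS]mulr1 ler_wpM2l.
have [v0|v0] := eqVneq (normV v) 0.
  by rewrite (normV_eq0 v0) linear0 normV0 mulr0.
have vp : 0 < normV v by rewrite lt_neqAle eq_sym v0 normV_ge0.
rewrite -ler_pdivrMr//; apply: (ub_le_sup ub).
exists ((normV v)^-1 *: v) => /=.
  by rewrite normVZ gtr0_norm ?invr_gt0// mulVf.
by rewrite linearZ /= normVZ gtr0_norm ?invr_gt0// mulrC.
Qed.

End Norms.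

Section Operators.
Variables (R : realType) (a b : R) (k : nat) (M : mesh a b).
Hypothesis hab : a < b.
Local Notation N := (ncell M).
Local Notation V := {ffun 'I_N -> {poly_(k.+1) R}}.
Local Notation D := (Dop M k).
Implicit Types (u v w z : V) (t : R) (T : seq R).

Definition mean z : R := ip a b (broken z) (cst 1).

Lemma constVE (c : R) j : val (constV M k c j) = c%:P.
Proof. rewrite ffunE; apply: npolypK; exact: leq_trans (size_polyC_leq1 _) _. Qed.

Lemma meanE1 z : mean z = ipV z (constV M k 1).
Proof.
rewrite /mean meanE ipVE; apply: eq_bigr => j _.
by rewrite constVE mulr1.
Qed.

Lemma mean_lin (c : R) u v : mean (c *: u + v) = c * mean u + mean v.
Proof. by rewrite !meanE1 ipV_lin. Qed.

Lemma mean0 : mean 0 = 0.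
Proof. by rewrite meanE1 (form0l (@ipV_lin _ _ _ M k)). Qed.

Lemma mean_const (c : R) : mean (constV M k c) = c * (b - a).
Proof.
rewrite /mean meanE -(sum_cells M) mulr_sumr; apply: eq_bigr => j _.
rewrite constVE -integ_cst ?(ltW (cell_lt j))//.
by apply: eq_integ => x _; rewrite hornerC.
Qed.

Lemma constVZ (c : R) : constV M k c = c *: constV M k 1.
Proof.
by apply/ffunP => j; apply/val_inj; rewrite [in RHS]ffunE linearZ /= !constVE -mul_polyC mulr1.
Qed.

(** Cellwise integration by parts; at an interface the two fluxes are
    complementary, so the jump of the product is split exactly. *)
Lemma Dop_adj t w v : ipV (D t w) v = - ipV w (D (1 - t) v).
Proof.
rewrite [ipV w _]ipV_sym !Dop_spec; apply/eqP; rewrite -addr_eq0; apply/eqP.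
rewrite !ip_derivE.
set A := \sum_j _; set B := \sum_(j < N) flux t w j * _.
set C := \sum_j _; set E := \sum_(j < N) flux (1 - t) v j * _.
suff : A + C = - (B + E) by move=> H; lra.
have -> : - (B + E) = \sum_(j < N) (trace_left w j * trace_left v j)
    - \sum_(j < N) (trace_right w j * trace_right v j).
  rewrite /B /E -big_split -sumrB -sumrN /=; apply: eq_bigr => j _.
  by rewrite /flux /jump; ring.
rewrite /A /C -big_split /=.
have -> : \sum_(j < N) (trace_right w j * trace_right v j) =
    \sum_(j < N) ((val (w j)).[node M j] * (val (v j)).[node M j]).
  by rewrite [RHS](reindex_inj (can_inj (@ordSK _))).
rewrite -sumrB; apply: eq_bigr => j _.
have /(integ_poly (ltW (cell_lt j))) :
    (val (w j) * val (v j))^`() = val (w j) * (val (v j))^`() + val (v j) * (val (w j))^`().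
  by rewrite derivM; ring.
rewrite -[X in horner (X + _)]scale1r -/(cellint j _) cellint_plin mul1r => ->.
by rewrite !hornerM.
Qed.

Lemma mean_Dop t v : mean (D t v) = 0.
Proof.
rewrite meanE1 Dop_spec ip_derivE !big1 ?oppr0 ?addr0// => j _; last first.
  by rewrite constVE derivC mulr0 cellint0.
by rewrite /jump /trace_left /trace_right !constVE !hornerC subrr mulr0.
Qed.

Lemma Dop_const t (c : R) : D t (constV M k c) = 0.
Proof.
apply: ipV_eq => v; rewrite Dop_adj constVZ.
have lin := @ipV_lin _ _ _ M k.
by rewrite (formZl lin) ipV_sym -meanE1 mean_Dop mulr0 oppr0 (form0l lin).
Qed.

Lemma close0 z : close z (fun=> 0) 0 -> z = 0.
Proof.
move=> /(normV_bound hab (lexx 0)); rewrite mulr0 => z0; apply: normV_eq0.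
by apply/le_anti; rewrite z0 normV_ge0.
Qed.

(** The case [w = 0] of [Dop_error], with both errors zero. *)
Lemma Dop_inj t z : t != 1 / 2 -> D t z = 0 -> mean z = 0 -> z = 0.
Proof.
move=> /(Dop_error k hab)[C C0 CE] Dz mz; apply: close0.
have := CE M z (fun=> 0) (fun=> 0) 0 0 (lexx 0); rewrite addr0 mulr0; apply.
- by move=> j x _; rewrite Dz ffunE horner0 subrr normr0.
- by move=> j; exists 0 => [|x _]; rewrite ?size_poly0// horner0 subrr normr0.
- rewrite -/(mean z) mz mean_fE integ_cst ?mul0r//; exact: ltW.
Qed.

(** Existence of a preimage of mean zero comes from injectivity, by
    dimension. *)
Lemma Dinv_spec t f : t != 1 / 2 -> mean f = 0 ->
  mean (Dinv t f) = 0 /\ D t (Dinv t f) = f.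
Proof.
move=> ht mf.
have ba : b - a != 0 by rewrite subr_eq0 gt_eqF.
(* Adding the mean turns the difference operator into an injective, hence
   bijective, endomorphism that agrees with it on functions of mean zero. *)
pose g z := D t z + mean z *: constV M k 1.
have glin : linear g.
  move=> c u v; rewrite /g linearP mean_lin scalerDl scalerDr -scalerA.
  by rewrite addrACA.
pose L : {linear V -> V} := HB.pack g (GRing.isLinear.Build _ _ _ _ g glin).
have mg z : mean (g z) = mean z * (b - a).
  have := mean_lin (mean z) (constV M k 1) (D t z); rewrite addrC -/(g z) => ->.
  by rewrite mean_const mul1r mean_Dop addr0.
have g0 z : mean (g z) = 0 -> mean z = 0.
  by rewrite mg => /eqP; rewrite mulf_eq0 (negPf ba) orbF => /eqP.
have ker : lker (linfun L) == 0%VS.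
  apply/lker0P => u v; rewrite !lfunE /= => guv; apply/eqP; rewrite -subr_eq0; apply/eqP.
  have : g (u - v) = 0 by have := linearB L u v; rewrite /= => ->; rewrite guv subrr.
  move=> guv0; have m0 : mean (u - v) = 0.
    by apply: g0; rewrite guv0 mean0.
  by apply: (@Dop_inj t) => //; move: guv0; rewrite /g m0 scale0r addr0.
have := memvf f; rewrite -(lker0_limgf ker) => /memv_imgP[z _]; rewrite lfunE /= => fE.
have mz : mean z = 0 by apply: g0; rewrite -fE.
have zE : D t z = f by rewrite fE /g mz scale0r addr0.
by have := @xgetI _ 0 [set z : V | Zh z /\ D t z = f] z (conj mz zE).
Qed.

Definition Dchain T v : V := foldr (fun t v => D t v) v T.
Definition Dinvchain T v : V := foldr (fun t v => Dinv t v) v T.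

Lemma Dchain_lin T (c : R) u v : Dchain T (c *: u + v) = c *: Dchain T u + Dchain T v.
Proof. by elim: T => //= t T ->; rewrite linearP. Qed.

Lemma Dchain_cat T T' v : Dchain (T ++ T') v = Dchain T (Dchain T' v).
Proof. by rewrite /Dchain foldr_cat. Qed.

Lemma Dchain0 T : Dchain T 0 = 0.
Proof. by elim: T => //= t T ->; rewrite linear0. Qed.

Lemma Dchain_const T (c : R) : T != [::] -> Dchain T (constV M k c) = 0.
Proof.
case/lastP: T => // T t _; rewrite -cats1 Dchain_cat /= Dop_const; exact: Dchain0.
Qed.

Lemma mean_Dchain T v : T != [::] -> mean (Dchain T v) = 0.
Proof. by case: T => //= t T _; exact: mean_Dop. Qed.

Lemma Dinvchain_spec T f : all (fun t => t != 1 / 2) T -> mean f = 0 ->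
  mean (Dinvchain T f) = 0 /\ Dchain (rev T) (Dinvchain T f) = f.
Proof.
elim: T => //= t T IH /andP[ht hT] mf; have [m1 m2] := IH hT mf.
have [d1 d2] := Dinv_spec ht m1; split => //.
by rewrite rev_cons -cats1 Dchain_cat /= d2.
Qed.

Lemma Dchain_adj T v w :
  ipV (Dchain T w) v = (-1) ^+ size T * ipV w (Dchain (rev [seq 1 - t | t <- T]) v).
Proof.
elim: T v => [|t T IH] v /=; first by rewrite expr0 mul1r.
by rewrite Dop_adj IH rev_cons -cats1 Dchain_cat /= exprS mulN1r mulNr.
Qed.

End Operators.

(** * The scheme as a product of difference operators *)

Section Scheme.
Variables (R : realType) (a b : R) (k : nat).
Hypothesis hab : a < b.
Implicit Types (T : seq R) (theta : nat -> R) (M : mesh a b).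

Lemma integ_deriv_periodic (f g : R -> R) : continuous g ->
  (forall x : R, is_derive x 1 f (g x)) -> f b = f a -> integ a b g = 0.
Proof. by move=> cg df fab; rewrite (integ_FTC (ltW hab) cg df) fab subrr. Qed.

(** Each factor applied backwards loses a constant and one new
    interpolation error.  The intermediate functions have mean zero: in the
    discrete case as images of [Dop], in the continuous one as derivatives
    of periodic functions. *)
Lemma Dchain_error T : all (fun t => t != 1 / 2) T -> exists2 C, 0 <= C &
  forall M (z : Vh M k) (g : nat -> R -> R) (A W : R), 0 <= A ->
    (forall i, (i < size T + k.+1)%N -> forall x : R, is_derive x 1 (g i) (g i.+1 x)) ->
    (forall i, (i < size T)%N -> g i b = g i a) ->
    (forall i, (i <= size T + k.+1)%N -> forall x, a <= x <= b -> `|g i x| <= W) ->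
    close (Dchain T z) (g (size T)) A -> mean z = integ a b (g 0%N) ->
    close z (g 0%N) (C * (A + W * mesh_size M ^+ k.+1)).
Proof.
elim: T => [|t T IH] /=.
  move=> _; exists 1 => // M z g A W A0 dg _ gW zA _ j x xj.
  rewrite mul1r; apply: le_trans (zA j x xj) _; rewrite lerDl mulr_ge0//.
    by apply: le_trans (gW 0%N _ a _) => //; rewrite lexx ltW.
  by rewrite exprn_ge0// ltW// mesh_size_gt0.
move=> /andP[/(Dop_error k hab)[C1 C10 C1E] /IH[C2 C20 C2E]].
exists (C2 * (C1 + 1)); first by rewrite mulr_ge0// addr_ge0.
move=> M z g A W A0 dg gper gW zA mz.
have h0 : 0 <= mesh_size M by rewrite ltW// mesh_size_gt0.
have W0 : 0 <= W by apply: le_trans (gW 0%N _ a _) => //; rewrite lexx ltW.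
have Wh : 0 <= W * mesh_size M ^+ k.+1 by rewrite mulr_ge0// exprn_ge0.
pose n := size T.
have dgn : forall x : R, is_derive x 1 (g n) (g n.+1 x) by apply: dg;
  rewrite addSn ltnS leq_addr.
have an : approx k M (g n) (W * mesh_size M ^+ k.+1).
  have := @smooth_approx _ _ _ k hab M (fun i => g (n + i)%N) W; rewrite addn0;
    apply => [i ik x|x xab].
    by rewrite addnS; apply: dg; rewrite addSn ltnS leq_add2l leqW.
  by apply: gW => //; rewrite addSn leqnSn.
have mn : mean (Dchain T z) = integ a b (g n).
  have [T0|Tn] := eqVneq T [::].
    by rewrite T0 /= mz /n T0.
  rewrite mean_Dchain//; have : (0 < n)%N by rewrite /n; case: (T) Tn.
  move: dgn; rewrite /n; case E : (size T) => [//|m] dgn _.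
  have dm : forall x : R, is_derive x 1 (g m) (g m.+1 x) by apply: dg; rewrite E;
    exact: (ltn_addr _ (leqnSn m.+1)).
  symmetry; apply: (integ_deriv_periodic _ dm); last by apply: gper; rewrite E leqnSn.
  by move=> x; exact: is_derive_cont (dgn x).
have := C1E M (Dchain T z) (g n) (g n.+1) A _ A0 dgn zA an.
rewrite -/(mean _) mn mean_fE => /(_ erefl) y1.
have y2 := C2E M z g _ W _ _ _ _ y1 mz.
move=> j x xj; apply: le_trans (y2 _ _ _ _ j x xj) _.
- by rewrite mulr_ge0// addr_ge0.
- by move=> i iT; apply: dg; exact: leqW.
- by move=> i iT; apply: gper; exact: leqW.
- by move=> i iT; apply: gW; exact: leqW.
- by rewrite -mulrA ler_wpM2l// [leRHS]mulrDl mul1r lerD2l lerDr.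
Qed.

(** The parameters of the difference operators whose product, outermost
    first, is the spatial operator divided by [beta]. *)
Definition factors q gamma theta : seq R :=
  [seq 1 - theta i | i <- rev (iota 1 gamma)] ++
  (if odd q then [:: theta 0%N] else [::]) ++ [seq theta i | i <- iota 1 gamma].

Lemma Kop_E M (theta : nat -> R) (s : seq nat) (v : Vh M k) :
  (\big[@comp_lfun R _ _ _ / \1%VF]_(i <- s) Dop M k (theta i)) v =
  Dchain [seq theta i | i <- s] v.
Proof.
elim: s v => [|i s IH] v; first by rewrite big_nil id_lfunE.
by rewrite big_cons comp_lfunE /= IH.
Qed.

(** Each transposition contributes a sign and reverses the order. *)
Lemma adjoint_Kop M gamma theta (v : Vh M k) :
  adjoint (Kop M k gamma theta) v =
  (-1) ^+ gamma *: Dchain [seq 1 - theta i | i <- rev (iota 1 gamma)] v.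
Proof.
pose B : 'End(Vh M k) := (-1) ^+ gamma *:
  \big[@comp_lfun R _ _ _ / \1%VF]_(i <- rev (iota 1 gamma)) Dop M k (1 - theta i).
rewrite (@adjoint_unique _ _ _ M k _ B) => [|{}v w].
  by rewrite /B scale_lfunE (Kop_E (fun i => 1 - theta i)).
rewrite /B scale_lfunE (Kop_E (fun i => 1 - theta i)).
rewrite (formZl (@ipV_lin _ _ _ M k)).
rewrite /Kop /index_iota subSS subn0 Kop_E (ipV_sym v) [RHS]Dchain_adj size_map size_iota.
by rewrite ipV_sym -!map_rev -map_comp.
Qed.

Lemma factors_size q gamma theta :
  ((q = 2 * gamma)%N \/ q = (2 * gamma + 1)%N) -> size (factors q gamma theta) = q.
Proof.
clear hab; move=> hq; rewrite /factors !size_cat !size_map size_rev size_iota.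
by case: hq => ->; rewrite ?addn1 /= oddM /=; lia.
Qed.

Lemma LopE M q gamma beta theta (v : Vh M k) :
  Lop M k q gamma beta theta v = beta *: Dchain (factors q gamma theta) v.
Proof.
rewrite /Lop scale_lfunE /factors !Dchain_cat.
have adjE w : Dchain [seq 1 - theta i | i <- rev (iota 1 gamma)] w =
   (-1) ^+ gamma *: adjoint (Kop M k gamma theta) w.
  by rewrite adjoint_Kop scalerA -exprMn mulrNN mulr1 expr1n scale1r.
rewrite adjE scalerA; congr (_ *: _); case: (odd q); rewrite !comp_lfunE.
all: by rewrite {2}/Kop /index_iota subSS subn0 Kop_E.
Qed.

Lemma factors_rev q gamma theta : factors q gamma theta =
  rev ([seq theta i | i <- rev (iota 1 gamma)] ++
       (if odd q then [:: theta 0%N] else [::]) ++ [seq 1 - theta i | i <- iota 1 gamma]).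
Proof.
by rewrite !rev_cat -!map_rev revK /factors catA; case: (odd q).
Qed.

Lemma foldr_Dinv M (f : nat -> R) s (v : Vh M k) :
  foldr (fun i v => Dinv (f i) v) v s = Dinvchain [seq f i | i <- s] v.
Proof. by elim: s => //= i s ->. Qed.

Lemma factors_ok q gamma theta : (forall i, (i <= gamma)%N -> theta i != 1 / 2) ->
  all (fun t => t != 1 / 2) (factors q gamma theta).
Proof.
clear hab; move=> ht; rewrite /factors !all_cat !all_map; apply/and3P; split.
- apply/allP => i; rewrite mem_rev mem_iota => /andP[_ ig] /=.
  have /ht : (i <= gamma)%N by lia.
  by apply: contra => /eqP E; apply/eqP; lra.
- by case: (odd q) => //=; rewrite ht.
- by apply/allP => i; rewrite mem_iota => /andP[_ ig] /=; apply: ht; lia.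
Qed.

Lemma mean_L2proj M (f : R -> R) : continuous f -> mean (L2proj M k f) = integ a b f.
Proof.
move=> cf; rewrite meanE1 L2proj_spec// ip_fE// (integ_whole M)//.
by apply: eq_bigr => j _; apply: eq_integ => x _; rewrite constVE hornerC mulr1.
Qed.

Lemma Pi_initE M q gamma theta (w : R -> R) :
  ((q = 2 * gamma /\ 1 <= gamma)%N \/ q = (2 * gamma + 1)%N) ->
  (forall i, (i <= gamma)%N -> theta i != 1 / 2) ->
  continuous (derive1n q w) -> integ a b (derive1n q w) = 0 ->
  Dchain (factors q gamma theta) (Pi_init M k q gamma theta w) = L2proj M k (derive1n q w)
  /\ mean (Pi_init M k q gamma theta w) = integ a b w.
Proof.
move=> hq ht cw iw.
have sz : size (factors q gamma theta) = q by apply: factors_size; case: hq => [[]|]; auto.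
have Tn : factors q gamma theta != [::].
  by rewrite -size_eq0 sz; case: hq => [[->]|->]; lia.
have ba : b - a != 0 by rewrite subr_eq0 gt_eqF.
pose T := [seq theta i | i <- rev (iota 1 gamma)] ++
       (if odd q then [:: theta 0%N] else [::]) ++ [seq 1 - theta i | i <- iota 1 gamma].
have TE : factors q gamma theta = rev T by exact: factors_rev.
have PE : Pi_init M k q gamma theta w = Dinvchain T (L2proj M k (derive1n q w)) +
    constV M k (integ a b w / (b - a)).
  rewrite /Pi_init !foldr_Dinv !mean_fE (integ_cst _ (ltW hab)) mul1r.
  by rewrite /T /Dinvchain !foldr_cat; case: (odd q).
have Tok : all (fun t => t != 1 / 2) T.
  by rewrite -all_rev -TE; exact: factors_ok.
have [m1 m2] := Dinvchain_spec hab Tok (etrans (mean_L2proj M cw) iw).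
rewrite PE -[Dinvchain _ _]scale1r Dchain_lin mean_lin !mul1r scale1r m1 add0r.
rewrite {1}TE m2 Dchain_const// addr0; split => //.
by rewrite mean_const// divfK.
Qed.

End Scheme.

(** * Sobolev and Taylor estimates, identities between derivatives *)

Section SobolevSup.
Variables (R : realType) (a b : R).
Hypothesis hab : a < b.

(** The first term bounds the minimum of the modulus of a function, the
    second its oscillation. *)
Definition sup_const (B : R) : R := `|B| / Num.sqrt (b - a) + (b - a + B ^+ 2) / 2.

Lemma sup_const_ge0 B : 0 <= sup_const B.
Proof.
have ba : 0 < b - a by rewrite subr_gt0.
apply: addr_ge0; first by rewrite divr_ge0 ?sqrtr_ge0.
by rewrite divr_ge0// addr_ge0 ?sqr_ge0 ?(ltW ba).
Qed.

Lemma integ_sub c d (f : R -> R) : continuous f -> (forall x, 0 <= f x) -> a <= c -> d <= b ->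
  integ c d f <= integ a b f.
Proof.
move=> cf f0 ac db.
have [mf _] := integrableP _ _ _ (cont_integrable a b cf).
have sub : [set` `[c, d]] `<=` [set` `[a, b]].
  move=> x /=; rewrite !in_itv/= => /andP[cx xd].
  by rewrite (le_trans ac)// (le_trans xd).
apply: fine_le.
- by apply: integrable_fin_num => //; exact: cont_integrable.
- by apply: integrable_fin_num => //; exact: cont_integrable.
- by apply: ge0_subset_integral => // x _; rewrite /= lee_fin.
Qed.

(** The minimum of [|f|] is at most its quadratic mean, and
    [|f'| <= (1 + f'^2) / 2] bounds the oscillation. *)
Lemma sobolev_sup (f f' : R -> R) B : continuous f' -> (forall x : R, is_derive x 1 f (f' x)) ->
  integ a b (fun x => f x ^+ 2) <= B ^+ 2 -> integ a b (fun x => f' x ^+ 2) <= B ^+ 2 ->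
  forall x, a <= x <= b -> `|f x| <= sup_const B.
Proof.
move=> cf' df If If' x /andP[ax xb].
have ba : 0 < b - a by rewrite subr_gt0.
have cf : continuous f by move=> y; exact: is_derive_cont (df y).
have [c] := EVT_min (ltW hab) (continuous_subspaceT (cont_norm cf)).
rewrite in_itv/= => /andP[ac cb] cmin.
have fc : `|f c| <= `|B| / Num.sqrt (b - a).
  rewrite ler_pdivlMr ?sqrtr_gt0// -ler_sqr ?nnegrE ?mulr_ge0 ?sqrtr_ge0//.
  rewrite exprMn !real_normK ?num_real// sqr_sqrtr ?(ltW ba)//.
  apply: le_trans If; rewrite -integ_cst ?(ltW hab)//.
  apply: le_integ; first exact: cont_cst.
    by under [X in continuous X]eq_fun do rewrite expr2; exact: contM.
  move=> y yab; rewrite -(real_normK (num_real (f c))) -(real_normK (num_real (f y))).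
  by rewrite ler_sqr ?nnegrE//; apply: cmin; rewrite in_itv.
pose g y := 2^-1 * (1 + f' y * f' y).
have cg : continuous g.
  by apply: contM; [exact: cont_cst|apply: contD; [exact: cont_cst|exact: contM]].
have g0 y : 0 <= g y by rewrite mulr_ge0// addr_ge0// -expr2 sqr_ge0.
have fg y : `|f' y| <= g y.
  rewrite /g -expr2 -real_normK ?num_real// ; have := sqr_ge0 (`|f' y| - 1); lra.
have Ig : integ a b g <= (b - a + B ^+ 2) / 2.
  rewrite /g integZ; last by apply: contD; [exact: cont_cst|exact: contM].
  rewrite integD; [|exact: cont_cst|exact: contM].
  rewrite integ_cst ?(ltW hab)// mul1r mulrC ler_wpM2r// lerD2l.
  by apply: le_trans If'; rewrite le_eqVlt; apply/orP; left; apply/eqP/eq_integ => y _;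
    rewrite expr2.
have diff y z : a <= y -> y <= z -> z <= b -> `|f z - f y| <= integ a b g.
  move=> ay yz zb; rewrite -(integ_FTC yz cf' df).
  apply: le_trans (le_norm_integ _ _ cf') _.
  apply: le_trans (integ_sub cg g0 ay zb).
  by apply: le_integ => //; exact: cont_norm.
have fxc : `|f x - f c| <= integ a b g.
  by have [xc|/ltW cx] := leP x c; [rewrite distrC|]; exact: diff.
have -> : f x = f c + (f x - f c) by ring.
apply: le_trans (ler_normD _ _) _; apply: lerD => //; exact: le_trans fxc Ig.
Qed.

End SobolevSup.

Section TimeTaylor.
Variable R : realType.

Definition taylor_poly n (g : nat -> R -> R) (t0 : R) : {poly R} :=
  \poly_(i < n) (g i t0 / i`!%:R).

Lemma taylor_poly_deriv n g t0 :
  (taylor_poly n.+1 g t0)^`() = taylor_poly n (fun i => g i.+1) t0.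
Proof.
apply/polyP => i; rewrite coef_deriv !coef_poly ltnS; case: ifP => _; last by rewrite mul0rn.
rewrite -[LHS]mulr_natr factS natrM; field.
by rewrite nat1r !pnatr_eq0 -lt0n fact_gt0.
Qed.

(** Induction on the order: the remainder vanishes at [t0] and its
    derivative is the remainder of the derivative.  At [t0] itself only
    continuity is assumed, which the mean value theorem allows. *)
Lemma time_taylor n (g : nat -> R -> R) (t0 T W : R) :
  (forall i, (i < n)%N -> forall t, t0 <= t -> {for t, continuous (g i)}) ->
  (forall i, (i < n)%N -> forall t : R, t0 < t -> is_derive t 1 (g i) (g i.+1 t)) ->
  (forall t, t0 <= t <= T -> `|g n t| <= W) ->
  forall t, t0 <= t <= T -> `|g 0%N t - (taylor_poly n g t0).[t - t0]| <= W * (t - t0) ^+ n.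
Proof.
elim: n g => [|n IH] g cg dg gW t /andP[t0t tT].
  by rewrite /taylor_poly poly_def big_ord0 horner0 subr0 expr0 mulr1 gW// t0t.
have [<-|tn] := eqVneq t0 t.
  rewrite subrr expr0n mulr0 horner_coef0 coef_poly /= fact0 divr1 subrr normr0//.
have {}t0t : t0 < t by rewrite lt_neqAle tn.
pose P := taylor_poly n.+1 g t0; pose l : {poly R} := 'X - t0%:P.
pose psi (r : R) := g 0%N r - (P \Po l).[r].
have lE r : (P \Po l).[r] = P.[r - t0] by rewrite horner_comp /l !hornerS.
have P' : (P \Po l)^`() = taylor_poly n (fun i => g i.+1) t0 \Po l.
  by rewrite deriv_comp /P taylor_poly_deriv /l derivB derivX derivC subr0 mulr1.
have dpsi r : r \in `]t0, t[ -> is_derive r 1 psi (g 1%N r - ((P \Po l)^`()).[r]).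
  rewrite in_itv/= => /andP[t0r _]; apply: is_deriveB; first exact: dg.
have cpsi : {within `[t0, t], continuous psi}.
  apply: continuous_in_subspaceT => r; rewrite inE/= in_itv/= => /andP[t0r _].
  by apply: cvgB; [exact: cg|exact: cont_poly].
have [c] := MVT t0t dpsi cpsi; rewrite in_itv/= => /andP[t0c ct].
have -> : psi t0 = 0.
  by rewrite /psi lE subrr horner_coef0 coef_poly /= fact0 divr1 subrr.
rewrite subr0 /psi lE => ->; rewrite P' horner_comp /l !hornerS.
rewrite normrM [`|t - t0|]gtr0_norm ?subr_gt0// exprSr mulrA ler_wpM2r ?subr_ge0 ?(ltW t0t)//.
have ctT : t0 <= c <= T by rewrite (ltW t0c) (le_trans (ltW ct)).
have W0 : 0 <= W by apply: le_trans (gW c ctT).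
apply: le_trans (IH (fun i => g i.+1) _ _ gW c ctT) _.
- by move=> i ni; exact: cg.
- by move=> i ni; exact: dg.
- rewrite ler_wpM2l// lerXn2r// ?nnegrE ?subr_ge0 ?(ltW t0c)//;
  first by rewrite ltW// (lt_trans t0c).
  by rewrite lerD2r ltW.
Qed.

End TimeTaylor.

Section SmoothDerivs.
Variables (R : realType) (m : nat) (u : R -> R -> R) (Du : nat -> nat -> R -> R -> R).
Hypothesis Dsm : smooth_derivs m u Du.

Lemma Du_u (t : R) : 0 <= t -> Du 0%N 0%N t = u t.
Proof. by case: Dsm => E _ _ _ t0; apply/funext => x; rewrite E. Qed.

Lemma Du_x i j (t x : R) : (i + j < m)%N -> 0 <= t -> is_derive x 1 (Du i j t) (Du i j.+1 t x).
Proof. by case: Dsm => _ E _ _; exact: E. Qed.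

Lemma Du_t i j (t x : R) : (i + j < m)%N -> 0 < t ->
  is_derive t 1 (fun r => Du i j r x) (Du i.+1 j t x).
Proof. by case: Dsm => _ _ E _; exact: E. Qed.

Lemma Du_cx i j (t : R) : (i + j < m)%N -> 0 <= t -> continuous (Du i j t).
Proof. by move=> ij t0 x; exact: is_derive_cont (Du_x x ij t0). Qed.

(** The absolute value extends the time variable to the whole line, since
    continuity at time 0 is one-sided. *)
Lemma Du_ct i j (x : R) : (i + j <= m)%N -> continuous (fun r : R => Du i j `|r| x).
Proof.
case: Dsm => _ _ _ /(_ i j) E ij r.
have /subspace_continuousP/(_ (`|r|, x)) := E ij; move/(_ (normr_ge0 r)) => H.
have pr : (`|s|, x) @[s --> r] --> within [set z : R * R | 0 <= z.1] (nbhs (`|r|, x)).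
  move=> A /= wA.
  have : (`|s|, x) @[s --> r] --> (`|r|, x).
    apply: (@cvg_pair _ _ _ (nbhs r) (nbhs `|r|) (nbhs x)).
      by apply: cvg_norm; exact: cvg_id.
    exact: cvg_cst.
  move=> /(_ _ wA) H1.
  have H2 : nbhs r (fun s : R => 0 <= `|s| -> A (`|s|, x)) := H1.
  by apply: filterS H2 => s; apply.
exact: (cvg_comp _ _ pr H).
Qed.

(** Both sides are continuous up to time 0, by [Du_ct]. *)
Lemma Du_extend i j i' j' (c x y : R) : (i + j <= m)%N -> (i' + j' <= m)%N ->
  (forall t, 0 < t -> Du i j t x = c * Du i' j' t y) ->
  forall t, 0 <= t -> Du i j t x = c * Du i' j' t y.
Proof.
move=> ij ij' E t; rewrite le_eqVlt => /predU1P[<-|]; last exact: E.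
have ch : continuous (fun r : R => Du i j `|r| x - c * Du i' j' `|r| y).
  by apply: contB; [exact: Du_ct|apply: contM; [exact: cont_cst|exact: Du_ct]].
have H : (fun r : R => Du i j `|r| x - c * Du i' j' `|r| y) r @[r --> 0^'+] --> (0 : R).
  apply: (@cvg_trans _ (0 @[_ --> (0:R)^'+])); last exact: cvg_cst.
  apply: near_eq_cvg; near=> r; rewrite /= E ?subrr//.
  by rewrite normr_gt0 gt_eqF//; near: r; exact: nbhs_right_gt.
have H2 := cvg_at_right_filter (ch 0).
have E0 := cvg_unique _ H2 H; apply/eqP; rewrite -subr_eq0; apply/eqP.
move: E0; rewrite normr0; apply => //; exact: norm_hausdorff.
Unshelve. all: by end_near.
Qed.

(** Differentiates an identity between derivatives in time; it holds
    at time 0 by continuity. *)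
Lemma Du_transfer i j i' j' (c x y : R) : (i + j < m)%N -> (i' + j' < m)%N ->
  (forall t, 0 <= t -> Du i j t x = c * Du i' j' t y) ->
  forall t, 0 <= t -> Du i.+1 j t x = c * Du i'.+1 j' t y.
Proof.
move=> ij ij' E; apply: Du_extend => // t t0.
have d1 := Du_t x ij t0; have d2 := Du_t y ij' t0.
have d3 : is_derive t 1 (fun r => Du i j r x) (c * Du i'.+1 j' t y).
  apply: (@near_eq_is_derive _ _ _ (fun r => c * Du i' j' r y)).
    near=> r; rewrite E// ltW//; near: r; exact: lt_nbhsr.
by rewrite -(derive_val (is_derive := d1)) (derive_val (is_derive := d3)).
Unshelve. all: by end_near.
Qed.

Lemma derive1n_Du i j (t : R) : (i + j <= m)%N -> 0 <= t -> derive1n j (Du i 0%N t) = Du i j t.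
Proof.
move=> + t0; elim: j => [|j IH] ij; first by rewrite derive1n0.
rewrite derive1nS IH; last by apply: leq_trans ij; rewrite leq_add2l.
apply/funext => x; rewrite derive1E.
have d := @Du_x i j t x; rewrite -addnS in d; exact: (derive_val (is_derive := d ij t0)).
Qed.

End SmoothDerivs.

(** * The exact solution; linear combinations *)

Section ExactSolution.
Variables (R : realType) (a b beta B : R) (q m : nat).
Variables (u : R -> R -> R) (Du : nat -> nat -> R -> R -> R).
Hypothesis hab : a < b.
Hypothesis Dsm : smooth_derivs m u Du.
Hypothesis per : forall t x : R, 0 <= t -> u t (x + (b - a)) = u t x.
Hypothesis pde : forall t x : R, 0 < t ->
  derive1 (fun r => u r x) t = beta * derive1n q (u t) x.
Hypothesis sob : forall t : R, 0 <= t -> sobolev_norm a b m Du t <= B.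

Lemma Du_periodic i j : (i + j <= m)%N -> forall t x : R, 0 <= t ->
  Du i j t (x + (b - a)) = Du i j t x.
Proof.
elim: i j => [|i IHi] j.
  elim: j => [|j IHj] jm t x t0; first by rewrite (Du_u Dsm) ?per.
  have d1 : is_derive x 1 (Du 0%N j t) (Du 0%N j.+1 t (x + (b - a))).
    have -> : Du 0%N j t = Du 0%N j t \o (fun y => y + (b - a)).
      by apply/funext => y /=; rewrite IHj// ltnW.
    rewrite -[X in is_derive _ _ _ X]mulr1.
    apply: is_derive1_comp; first exact: (Du_x Dsm).
    rewrite -[X in is_derive _ _ _ X]addr0; apply: is_deriveD.
  have d2 := Du_x Dsm (i := 0) x jm t0.
  by rewrite -(derive_val (is_derive := d1)) (derive_val (is_derive := d2)).
rewrite addSn => ij t x t0; rewrite -[RHS]mul1r.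
by apply: (Du_transfer Dsm) => // r r0; rewrite mul1r IHi// ltnW.
Qed.

(** Obtained from the equation by time derivatives alone, without
    exchanging derivatives in time and space. *)
Lemma Du_pde i : (i + q < m)%N -> forall t x : R, 0 <= t ->
  Du i.+1 0%N t x = beta * Du i q t x.
Proof.
elim: i => [|i IH] iq t x t0.
  apply: (Du_extend Dsm) => //; [exact: leq_ltn_trans iq|exact: ltnW|move=> {t0}t t0].
  have d := Du_t Dsm (i := 0) (j := 0) x (leq_ltn_trans (leq0n _) iq) t0.
  rewrite -(derive_val (is_derive := d)) -(derive1n_Du Dsm (ltnW iq) (ltW t0)) (Du_u Dsm
    (ltW t0)).
  rewrite -pde// derive1E; apply: near_eq_derive.
  near=> r; rewrite (Du_u Dsm)// ltW//; near: r; exact: lt_nbhsr.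
have iq' : (i + q < m)%N by apply: leq_trans iq; rewrite addSn.
apply: (Du_transfer Dsm) => //; last by move=> r r0; exact: IH.
by apply: leq_ltn_trans iq; rewrite addn0 addSn ltnS leq_addr.
Unshelve. all: by end_near.
Qed.

Lemma L2norm_sqr (f : R -> R) : L2norm a b f ^+ 2 = integ a b (fun x => f x ^+ 2).
Proof.
have fE : ip a b f f = integ a b (fun x => f x ^+ 2).
  by apply: eq_integ => x _; rewrite expr2.
by rewrite /L2norm sqr_sqrtr fE// integ_ge0// => x _; exact: sqr_ge0.
Qed.

Lemma sobolev_L2 i j t : (i + j <= m)%N -> 0 <= t ->
  integ a b (fun x => Du i j t x ^+ 2) <= B ^+ 2.
Proof.
move=> ij t0; rewrite -L2norm_sqr.
have B0 : 0 <= B by apply: le_trans (sob t0); exact: sqrtr_ge0.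
have S0 : 0 <= \sum_(i < m.+1) \sum_(j < m.+1 | (i + j <= m)%N) L2norm a b (Du i j t) ^+ 2.
  by apply: sumr_ge0 => i' _; apply: sumr_ge0 => j' _; exact: sqr_ge0.
have := sob t0; rewrite -ler_sqr ?nnegrE ?sqrtr_ge0// sqr_sqrtr//; apply: le_trans.
have im : (i < m.+1)%N by rewrite ltnS (leq_trans _ ij)// leq_addr.
have jm : (j < m.+1)%N by rewrite ltnS (leq_trans _ ij)// leq_addl.
rewrite (bigD1 (Ordinal im))//= (bigD1 (Ordinal jm))//= -addrA lerDl addr_ge0//.
  by apply: sumr_ge0 => j' _; exact: sqr_ge0.
by apply: sumr_ge0 => i' _; apply: sumr_ge0 => j' _; exact: sqr_ge0.
Qed.

Lemma Du_sup i j t x : (i + j.+1 < m)%N -> 0 <= t -> a <= x <= b ->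
  `|Du i j t x| <= sup_const a b B.
Proof.
move=> ij t0; have ij' : (i + j < m)%N by apply: leq_trans ij; rewrite addnS.
apply: (@sobolev_sup _ _ _ hab (Du i j t) (Du i j.+1 t)).
- exact: (Du_cx Dsm).
- by move=> y; exact: (Du_x Dsm).
- by apply: sobolev_L2 => //; exact: ltnW.
- by apply: sobolev_L2 => //; exact: ltnW.
Qed.

End ExactSolution.

Section LinearCombinations.
Variables (R : realType) (a b : R) (k : nat) (M : mesh a b).
Hypothesis hab : a < b.
Local Notation N := (ncell M).
Local Notation V := {ffun 'I_N -> {poly_(k.+1) R}}.

Lemma cont_sum n (c : nat -> R) (f : nat -> R -> R) :
  (forall i, (i < n)%N -> continuous (f i)) ->
  continuous (fun x => \sum_(i < n) c i * f i x).
Proof.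
elim: n => [|n IH] cf.
  have -> : (fun x : R => \sum_(i < 0) c i * f i x) = (fun=> 0).
    by apply/funext => x; rewrite big_ord0.
  exact: cont_cst.
have -> : (fun x : R => \sum_(i < n.+1) c i * f i x) =
    (fun x => \sum_(i < n) c i * f i x + c n * f n x).
  by apply/funext => x; rewrite big_ord_recr.
apply: contD; first by apply: IH => i ni; apply: cf; exact: ltnW.
by apply: contM; [exact: cont_cst|exact: cf].
Qed.

Lemma L2proj_lin (c : R) (f g : R -> R) : continuous f -> continuous g ->
  L2proj M k (fun x => c * f x + g x) = c *: L2proj M k f + L2proj M k g.
Proof.
move=> cf cg; have ccf : continuous (fun x => c * f x) by apply: contM => //; exact: cont_cst.
apply: ipV_eq => v; rewrite ipV_lin !L2proj_spec//; last exact: contD.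
rewrite !ip_fE//; last exact: contD.
rewrite mulr_sumr -big_split; apply: eq_bigr => j _ /=.
rewrite -cellint_lin; [|by apply: contM => //; exact: cont_poly..].
by apply: eq_integ => x _; ring.
Qed.

Lemma L2projZ (c : R) (f : R -> R) : continuous f ->
  L2proj M k (fun x => c * f x) = c *: L2proj M k f.
Proof.
move=> cf; apply: ipV_eq => v; rewrite (formZl (@ipV_lin _ _ _ M k)) !L2proj_spec//; last first.
  by apply: contM => //; exact: cont_cst.
rewrite !ip_fE//; last by apply: contM => //; exact: cont_cst.
rewrite mulr_sumr; apply: eq_bigr => j _ /=.
rewrite -cellintZ; last by apply: contM => //; exact: cont_poly.
by apply: eq_integ => x _; ring.
Qed.

Lemma L2proj_sum n (c : nat -> R) (f : nat -> R -> R) :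
  (forall i, (i < n)%N -> continuous (f i)) ->
  L2proj M k (fun x => \sum_(i < n) c i * f i x) = \sum_(i < n) c i *: L2proj M k (f i).
Proof.
elim: n => [|n IH] cf.
  rewrite big_ord0 -(scale0r (L2proj M k (fun=> 0))) -L2projZ; last exact: cont_cst.
  by congr (L2proj _ _ _); apply/funext => x; rewrite big_ord0 mul0r.
rewrite big_ord_recr /= addrC -IH; last by move=> i ni; apply: cf; exact: ltnW.
rewrite -L2proj_lin; [|exact: cf|].
  by congr (L2proj _ _ _); apply/funext => x; rewrite big_ord_recr /= addrC.
by apply: cont_sum => i ni; apply: cf; exact: ltnW.
Qed.

Lemma Dchain_sum T n (c : nat -> R) (f : nat -> V) :
  Dchain T (\sum_(i < n) c i *: f i) = \sum_(i < n) c i *: Dchain T (f i).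
Proof.
elim: n => [|n IH]; first by rewrite !big_ord0 Dchain0.
by rewrite !big_ord_recr /= addrC Dchain_lin IH addrC.
Qed.

Lemma mean_sum n (c : nat -> R) (f : nat -> V) :
  mean (\sum_(i < n) c i *: f i) = \sum_(i < n) c i * mean (f i).
Proof.
elim: n => [|n IH]; first by rewrite !big_ord0 mean0.
by rewrite !big_ord_recr /= addrC mean_lin IH addrC.
Qed.

Lemma integ_sum n (c : nat -> R) (f : nat -> R -> R) :
  (forall i, (i < n)%N -> continuous (f i)) ->
  integ a b (fun x => \sum_(i < n) c i * f i x) = \sum_(i < n) c i * integ a b (f i).
Proof.
elim: n => [|n IH] cf.
  rewrite big_ord0 -[RHS](mul0r (b - a)) -(integ_cst _ (ltW hab)).
  by apply: eq_integ => x _; rewrite big_ord0.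
have cS : continuous (fun x => \sum_(i < n) c i * f i x).
  by apply: cont_sum => i ni; apply: cf; exact: ltnW.
have cn : continuous (fun x => c n * f n x) by apply: contM; [exact: cont_cst|exact: cf].
rewrite big_ord_recr /= -IH; last by move=> i ni; apply: cf; exact: ltnW.
rewrite -integZ; last exact: cf.
by rewrite -integD//; apply: eq_integ => x _; rewrite big_ord_recr.
Qed.

Lemma RsE s (alpha : nat -> R) (A : 'End(V)) v :
  Rs s alpha A v = \sum_(i < s.+1) alpha i *: iter i A v.
Proof.
rewrite /Rs sum_lfunE; apply: eq_bigr => i _; rewrite scale_lfunE; congr (_ *: _).
by elim: (nat_of_ord i) => [|n IH] /=; rewrite ?id_lfunE// comp_lfunE IH.
Qed.

End LinearCombinations.

(** * Error in time *)

(** One step of the discrete Gronwall inequality, from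
    [1 + mu tau <= exp (mu tau)]. *)
Lemma sigma_step (R : realType) (mu tau : R) (n : nat) : 0 <= mu -> 0 < tau ->
  (1 + mu * tau) * sigma_growth mu (n%:R * tau) + tau <= sigma_growth mu (n.+1%:R * tau).
Proof.
move=> mu0 tau0; rewrite /sigma_growth; case: eqVneq => [->|mn0].
  by rewrite mul0r addr0 mul1r -nat1r mulrDl mul1r addrC.
have mup : 0 < mu by rewrite lt_neqAle eq_sym mn0.
have -> : mu * (n.+1%:R * tau) = mu * tau + mu * (n%:R * tau) by rewrite -nat1r; ring.
rewrite expRD ler_pdivlMr//.
have E1 := expR_ge1Dx (mu * tau); have E2 := expR_ge0 (mu * (n%:R * tau)).
have H : (1 + mu * tau) * expR (mu * (n%:R * tau)) <= expR (mu * tau) * expR (mu * (n%:R *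
  tau)).
  by rewrite ler_wpM2r.
set e := expR (mu * (n%:R * tau)) in E2 H *.
have -> : ((1 + mu * tau) * ((e - 1) / mu) + tau) * mu = (1 + mu * tau) * e - 1 by field.
lra.
Qed.

Lemma sigma_ge0 (R : realType) (mu t : R) : 0 <= mu -> 0 <= t -> 0 <= sigma_growth mu t.
Proof.
move=> mu0 t0; rewrite /sigma_growth; case: ifP => // _.
by rewrite divr_ge0// subr_ge0 -expR0 ler_expR mulr_ge0.
Qed.

Lemma lfunBZ (R : realType) (V : vectType R) (A : 'End(V)) (x y : V) (c : R) :
  A (x - c *: y) = A x - c *: A y.
Proof. by rewrite linearB linearZ. Qed.

Section Evolution.
Variables (R : realType) (a b : R) (k q gamma p s m : nat).
Variables (beta B : R) (theta alpha : nat -> R).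
Hypothesis hab : a < b.
Hypothesis hq : (q = 2 * gamma /\ 1 <= gamma)%N \/ q = (2 * gamma + 1)%N.
Hypothesis htheta : forall i, (i <= gamma)%N -> theta i != 1 / 2.
Hypothesis halpha : forall i, (i <= p)%N -> alpha i = 1 / (i`!)%:R.
Hypothesis hps : (p <= s)%N.
Hypothesis hm : (s + q + k + 5 <= m)%N.
Variables (u : R -> R -> R) (Du : nat -> nat -> R -> R -> R).
Hypothesis Dsm : smooth_derivs m u Du.
Hypothesis per : forall t x : R, 0 <= t -> u t (x + (b - a)) = u t x.
Hypothesis pde : forall t x : R, 0 < t ->
  derive1 (fun r => u r x) t = beta * derive1n q (u t) x.
Hypothesis sob : forall t : R, 0 <= t -> sobolev_norm a b m Du t <= B.

Variables Cp Cd : R.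
Hypothesis Cp0 : 0 <= Cp.
Hypothesis Cd0 : 0 <= Cd.
Hypothesis CpE : forall (M : mesh a b) w e,
  continuous w -> approx k M w e -> close (L2proj M k w) w (Cp * e).
Hypothesis CdE : forall (M : mesh a b) (z : Vh M k) (g : nat -> R -> R) (A W : R), 0 <= A ->
    (forall i, (i < q + k.+1)%N -> forall x : R, is_derive x 1 (g i) (g i.+1 x)) ->
    (forall i, (i < q)%N -> g i b = g i a) ->
    (forall i, (i <= q + k.+1)%N -> forall x, a <= x <= b -> `|g i x| <= W) ->
    close (Dchain (factors q gamma theta) z) (g q) A -> mean z = integ a b (g 0%N) ->
    close z (g 0%N) (Cd * (A + W * mesh_size M ^+ k.+1)).

Variables (M : mesh a b) (tau : R).
Hypothesis h1 : mesh_size M <= 1.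
Hypothesis tau0 : 0 < tau.
Hypothesis tau1 : tau <= 1.

Local Notation T := (factors q gamma theta).
Local Notation V := (Vh M k).
Local Notation W := (sup_const a b B).
Local Notation hk := (mesh_size M ^+ k.+1).
Local Notation Lh := (Lop M k q gamma beta theta).
Hypothesis contr : forall v : V, normV ((tau *: Lh) v) <= normV v.

(** The discrete counterpart of the [i]-th time derivative of the solution. *)
Definition Pi i t : V := Pi_init M k q gamma theta (Du i 0%N t).

Lemma W_ge0 : 0 <= W. Proof. exact: sup_const_ge0. Qed.

Lemma hk_ge0 : 0 <= hk.
Proof. by rewrite exprn_ge0// ltW// mesh_size_gt0. Qed.

Lemma q_gt0 : (0 < q)%N. Proof. by case: hq => [[->]|->]; lia. Qed.

Lemma sup_Du i j (t x : R) : (i <= s.+1)%N -> (j <= q + k.+1)%N -> 0 <= t -> a <= x <= b ->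
  `|Du i j t x| <= W.
Proof. by move=> is1 jq; apply: (Du_sup hab Dsm sob); lia. Qed.

Lemma dx_Du i j (t x : R) : (i <= s.+1)%N -> (j <= q + k.+1)%N -> 0 <= t ->
  is_derive x 1 (Du i j t) (Du i j.+1 t x).
Proof. by move=> is1 jq t0; apply: (Du_x Dsm) => //; lia. Qed.

Lemma c_Du i j (t : R) : (i <= s.+1)%N -> (j <= q + k.+1)%N -> 0 <= t -> continuous (Du i j t).
Proof. by move=> is1 jq t0 x; exact: is_derive_cont (dx_Du x is1 jq t0). Qed.

Lemma per_Du i j (t : R) : (i <= s.+1)%N -> (j <= q + k.+1)%N -> 0 <= t ->
  Du i j t b = Du i j t a.
Proof.
move=> is1 jq t0; have ijm : (i + j <= m)%N by lia.
by have := Du_periodic Dsm per ijm a t0; rewrite addrC subrK.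
Qed.

Lemma L2_err i j t : (i <= s.+1)%N -> (j <= q)%N -> 0 <= t ->
  close (L2proj M k (Du i j t)) (Du i j t) (Cp * (W * hk)).
Proof.
move=> is1 jq t0; apply: CpE; first by apply: c_Du => //; lia.
have := @smooth_approx _ _ _ k hab M (fun l => Du i (j + l)%N t) W; rewrite addn0;
  apply => [l lk x|x xab].
  by rewrite addnS; apply: dx_Du => //; lia.
by apply: sup_Du => //; lia.
Qed.

Lemma Pi_spec i t : (i <= s.+1)%N -> 0 <= t ->
  Dchain T (Pi i t) = L2proj M k (Du i q t) /\ mean (Pi i t) = integ a b (Du i 0%N t).
Proof.
move=> is1 t0; have iqm : (i + q <= m)%N by lia.
have E := derive1n_Du Dsm iqm t0.
have := @Pi_initE _ _ _ k hab M q gamma theta (Du i 0%N t) hq htheta; rewrite E; apply.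
  by apply: c_Du => //; lia.
have q1 : (q.-1.+1 = q)%N by rewrite prednK// q_gt0.
have d : forall x : R, is_derive x 1 (Du i q.-1 t) (Du i q t x).
  by move=> x; rewrite -{2}q1; apply: dx_Du => //; lia.
apply: (integ_deriv_periodic hab _ d); last by apply: per_Du => //; lia.
by apply: c_Du => //; lia.
Qed.

Definition projC : R := Cp + Cd * (Cp + 1).

Lemma Pi_err i t : (i <= s)%N -> 0 <= t ->
  close (Pi i t) (Du i 0%N t) (Cd * (Cp * (W * hk) + W * hk)).
Proof.
move=> is1 t0; have [P1 P2] := Pi_spec (leqW is1) t0.
have Whk : 0 <= W * hk by rewrite mulr_ge0 ?W_ge0 ?hk_ge0.
apply: (CdE (g := fun j => Du i j t)) => //.
- by rewrite mulr_ge0.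
- by move=> j jq x; exact: dx_Du (leqW is1) (ltnW jq) t0.
- by move=> j jq; exact: per_Du (leqW is1) (leq_trans (ltnW jq) (leq_addr _ _)) t0.
- by move=> j jq x; exact: sup_Du (leqW is1) jq t0.
- by rewrite P1; exact: L2_err (leqW is1) (leqnn q) t0.
Qed.

Lemma normV_close (v w : V) (f : R -> R) (e1 e2 : R) : 0 <= e1 -> 0 <= e2 ->
  close v f e1 -> close w f e2 -> normV (v - w) <= Num.sqrt (b - a) * (e1 + e2).
Proof.
move=> e10 e20 vf wf; apply: normV_bound; [exact: hab|by rewrite addr_ge0|].
move=> j x xj; rewrite subr0.
have -> : (val ((v - w) j)).[x] = ((val (v j)).[x] - f x) - ((val (w j)).[x] - f x).
  by rewrite addrC -scaleN1r val_lin !hornerS; ring.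
by apply: le_trans (ler_normB _ _) _; rewrite lerD ?vf ?wf.
Qed.

(** Bound for the defect of [Pi] in the semidiscrete equation. *)
Definition Delta : R := Num.sqrt (b - a) * (projC * (W * hk)).

(** The left term is exactly the L2 projection of the next time
    derivative, by the equation; both terms are then compared with that
    derivative. *)
Lemma L_Pi i t : (i < s)%N -> 0 <= t -> normV (Lh (Pi i t) - Pi i.+1 t) <= Delta.
Proof.
move=> is1 t0; have iq : (i + q < m)%N by lia.
have [P1 P2] := Pi_spec (leqW (ltnW is1)) t0.
have Whk : 0 <= W * hk by rewrite mulr_ge0 ?W_ge0 ?hk_ge0.
have CW : 0 <= Cp * (W * hk) by rewrite mulr_ge0.
have -> : Lh (Pi i t) = L2proj M k (Du i.+1 0%N t).
  rewrite LopE P1 -L2projZ; last exact: c_Du (leqW (ltnW is1)) (leq_addr _ _) t0.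
  by congr (L2proj _ _ _); apply/funext => x; rewrite (Du_pde Dsm pde).
have H1 := L2_err (leqW is1) (leq0n q) t0; have H2 := Pi_err is1 t0.
have := normV_close CW _ H1 H2; rewrite mulr_ge0 ?addr_ge0// => /(_ isT) /le_trans; apply.
rewrite /Delta /projC le_eqVlt; apply/orP; left; apply/eqP; ring.
Qed.

(** Each further application of the contraction [tau L] keeps the old
    error and adds one defect of size [tau Delta]. *)
Lemma iter_Pi i t : (i <= s)%N -> 0 <= t ->
  normV (iter i (tau *: Lh) (Pi 0 t) - tau ^+ i *: Pi i t) <= i%:R * (tau * Delta).
Proof.
move=> + t0; elim: i => [|i IH] is1.
  by rewrite expr0 scale1r subrr normV0 mul0r.
have AE w : (tau *: Lh) w = tau *: Lh w by rewrite scale_lfunE.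
have -> : iter i.+1 (tau *: Lh) (Pi 0 t) - tau ^+ i.+1 *: Pi i.+1 t =
    (tau *: Lh) (iter i (tau *: Lh) (Pi 0 t) - tau ^+ i *: Pi i t)
    + tau ^+ i.+1 *: (Lh (Pi i t) - Pi i.+1 t).
  rewrite lfunBZ iterS (AE (Pi i t)) (scalerA (tau ^+ i) tau (Lh (Pi i t))) -exprSr.
  by rewrite scalerBr addrA subrK.
apply: le_trans (normVD _ _) _; rewrite -natr1 mulrDl mul1r lerD//.
  by apply: le_trans (contr _) _; apply: IH; exact: ltnW.
rewrite normVZ ger0_norm ?exprn_ge0 ?(ltW tau0)// ler_pM ?normV_ge0 ?exprn_ge0 ?(ltW tau0)//.
  by rewrite exprS ler_piMr ?(ltW tau0)// exprn_ile1// ltW.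
exact: L_Pi.
Qed.

Definition stageC : R := \sum_(i < s.+1) `|alpha i| * i%:R.

Lemma stageC_ge0 : 0 <= stageC.
Proof. by apply: sumr_ge0 => i _; rewrite mulr_ge0. Qed.

Lemma Rs_Pi t : 0 <= t ->
  normV (Rs s alpha (tau *: Lh) (Pi 0 t) - \sum_(i < s.+1) (alpha i * tau ^+ i) *: Pi i t)
    <= stageC * (tau * Delta).
Proof.
move=> t0; rewrite RsE -sumrB; apply: le_trans (normV_sum _) _.
rewrite mulr_suml; apply: ler_sum => i _.
rewrite -scalerA -scalerBr normVZ -mulrA ler_wpM2l//; apply: iter_Pi => //.
by rewrite -ltnS ltn_ord.
Qed.

Definition taylorC : R := 1 + \sum_(i < s.+1) `|alpha i|.

Lemma taylorC_ge0 : 0 <= taylorC.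
Proof. by rewrite addr_ge0// sumr_ge0. Qed.

(** Below order [p] the stages reproduce Taylor's formula; the others
    are of order [tau^(p+1)]. *)
Lemma time_consistency j t x : (j <= q)%N -> 0 <= t -> a <= x <= b ->
  `|Du 0%N j (t + tau) x - \sum_(i < s.+1) (alpha i * tau ^+ i) * Du i j t x|
    <= taylorC * (W * tau ^+ p.+1).
Proof.
move=> jq; have pj i : (i <= p.+1)%N -> (i + j < m)%N by lia.
have jq' : (j <= q + k.+1)%N by exact: leq_trans jq (leq_addr _ _).
move=> t0 xab.
pose g i (r : R) := Du i j `|r| x.
have cg i : (i < p.+1)%N -> forall r, t <= r -> {for r, continuous (g i)}.
  by move=> ip r _; apply: (Du_ct Dsm); exact: ltnW (pj i (ltnW ip)).
have dg i : (i < p.+1)%N -> forall r : R, t < r -> is_derive r 1 (g i) (g i.+1 r).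
  move=> ip r tr; have r0 : 0 < r by exact: le_lt_trans tr.
  rewrite /g [in X in is_derive _ _ _ X]gtr0_norm//.
  apply: (@near_eq_is_derive _ _ _ (fun r => Du i j r x)).
    near=> z; rewrite gtr0_norm//; near: z; exact: lt_nbhsr.
  exact: (Du_t Dsm) (pj i (ltnW ip)) r0.
have gW r : t <= r <= t + tau -> `|g p.+1 r| <= W.
  by move=> /andP[tr _]; exact: sup_Du (hps : (p.+1 <= s.+1)%N) jq' (normr_ge0 _) xab.
have tt : t <= t + tau <= t + tau by rewrite lexx lerDl ltW.
have := time_taylor cg dg gW tt.
rewrite /g [t + tau - t]addrC addKr [`|t + tau|]ger0_norm ?addr_ge0 ?(ltW tau0)// => H.
have E : \sum_(i < s.+1) (alpha i * tau ^+ i) * Du i j t x =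
    (taylor_poly p.+1 g t).[tau] + \sum_(p.+1 <= i < s.+1) (alpha i * tau ^+ i) * Du i j t x.
  rewrite -(big_mkord xpredT (fun i => alpha i * tau ^+ i * Du i j t x)).
  rewrite (big_cat_nat (n := p.+1))//=; congr (_ + _).
  rewrite /taylor_poly horner_poly big_mkord; apply: eq_bigr => i _.
  have ip : (i <= p)%N by rewrite -ltnS ltn_ord.
  by rewrite halpha// /g (ger0_norm t0) div1r; ring.
rewrite E opprD addrA; apply: le_trans (ler_normB _ _) _.
rewrite /taylorC mulrDl mul1r; apply: lerD; first exact: H.
apply: le_trans (ler_norm_sum _ _ _) _; rewrite mulr_suml.
rewrite -(big_mkord xpredT (fun i => `|alpha i| * (W * tau ^+ p.+1))).
rewrite [leRHS](big_cat_nat (n := p.+1))//= -[leLHS]add0r; apply: lerD.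
  by apply: sumr_ge0 => i _; rewrite !mulr_ge0 ?W_ge0 ?exprn_ge0 ?(ltW tau0).
rewrite [leLHS]big_nat_cond [leRHS]big_nat_cond; apply: ler_sum => i /andP[/andP[pi is1] _].
rewrite !normrM -mulrA ler_wpM2l// mulrC [`|_ ^+ _|]ger0_norm ?exprn_ge0 ?(ltW tau0)//.
apply: ler_pM; rewrite ?exprn_ge0 ?(ltW tau0)//.
  exact: sup_Du (ltnW is1) jq' t0 xab.
by rewrite ler_wiXn2l// ltW.
Unshelve. all: by end_near.
Qed.

Definition stepC : R :=
  Num.sqrt (b - a) * (Cd * ((Cp + 1) * taylorC + taylorC) + taylorC).

Lemma stepC_ge0 : 0 <= stepC.
Proof.
have tc := taylorC_ge0.
by rewrite mulr_ge0 ?sqrtr_ge0// addr_ge0// mulr_ge0// addr_ge0// mulr_ge0// addr_ge0.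
Qed.

(** The product of difference operators maps the left-hand difference to
    the projection of a Taylor remainder, and its mean is that of a Taylor
    remainder, so stability of the inverse ([Dchain_error] with a constant
    function) bounds it. *)
Lemma step_Pi t : 0 <= t ->
  normV (Pi 0 (t + tau) - \sum_(i < s.+1) (alpha i * tau ^+ i) *: Pi i t)
    <= stepC * (W * tau ^+ p.+1).
Proof.
move=> t0; have t1 : 0 <= t + tau by rewrite addr_ge0// ltW.
have ba : 0 < b - a by rewrite subr_gt0.
pose c i := alpha i * tau ^+ i.
pose z := Pi 0 (t + tau) - \sum_(i < s.+1) c i *: Pi i t; rewrite -/z.
have zE : z = (-1) *: (\sum_(i < s.+1) c i *: Pi i t) + Pi 0 (t + tau).
  by rewrite scaleN1r addrC.
pose e := taylorC * (W * tau ^+ p.+1).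
have e0 : 0 <= e by rewrite mulr_ge0 ?taylorC_ge0// mulr_ge0 ?W_ge0 ?exprn_ge0 ?(ltW tau0).
pose G j x := (-1) * (\sum_(i < s.+1) c i * Du i j t x) + Du 0%N j (t + tau) x.
have jqk j : (j <= q)%N -> (j <= q + k.+1)%N by move=> jq; exact: leq_trans jq (leq_addr _ _).
have cS j : (j <= q)%N -> continuous (fun x => \sum_(i < s.+1) c i * Du i j t x).
  move=> jq; apply: (@cont_sum _ s.+1 c (fun i => Du i j t)) => i ip.
  exact: c_Du (ltnW ip) (jqk j jq) t0.
have c0 j : (j <= q)%N -> continuous (Du 0%N j (t + tau)).
  by move=> jq; exact: c_Du (leq0n _) (jqk j jq) t1.
have cG j : (j <= q)%N -> continuous (G j).
  by move=> jq; apply: contD; [apply: contM; [exact: cont_cst|exact: cS]|exact: c0].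
have Ge j x : (j <= q)%N -> a <= x <= b -> `|G j x| <= e.
  by move=> jq xab; rewrite /G mulN1r addrC; exact: time_consistency.
have Dz : Dchain T z = L2proj M k (G q).
  rewrite zE Dchain_lin (@Dchain_sum _ _ _ k M T s.+1 c (fun i => Pi i t)) L2proj_lin;
    [|exact: cS|exact: c0].
  rewrite (Pi_spec (leq0n _) t1).1; congr (_ *: _ + _).
  rewrite (@L2proj_sum _ _ _ _ M s.+1 c (fun i => Du i q t)) => [|i ip]; last first.
    exact: c_Du (ltnW ip) (jqk _ _) t0.
  by apply: eq_bigr => i _; rewrite (Pi_spec _ t0).1// ltnW.
have mz : mean z = integ a b (G 0%N).
  rewrite zE mean_lin (@mean_sum _ _ _ k M s.+1 c (fun i => Pi i t)) (Pi_spec (leq0n _) t1).2.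
  have cS1 : continuous (fun x => (-1) * \sum_(i < s.+1) c i * Du i 0%N t x).
    by apply: contM; [exact: cont_cst|exact: cS].
  rewrite integD//; last exact: c0.
  rewrite integZ; last exact: cS.
  rewrite (@integ_sum _ _ _ hab s.+1 c (fun i => Du i 0%N t)) => [|i ip]; last first.
    exact: c_Du (ltnW ip) (jqk _ _) t0.
  congr (_ * _ + _); apply: eq_bigr => i _.
  by rewrite (Pi_spec _ t0).2// ltnW.
pose d := mean z / (b - a).
have dE : `|d| <= e.
  rewrite /d normrM normfV [`|b - a|]gtr0_norm// ler_pdivrMr// mz.
  apply: bound_integ; [exact: ltW|exact: cG|by move=> x; exact: Ge].
(* Compare z with its mean value d; the term in hk is harmless as hk <= 1. *)
pose g i : R -> R := if i == 0%N then (fun=> d) else (fun=> 0).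
have zd : close z (g 0%N) (Cd * ((Cp + 1) * e + e * hk)).
  apply: CdE.
  - by rewrite mulr_ge0// addr_ge0.
  - by move=> i _ x; rewrite /g /=; case: eqP => _; exact: is_derive_cst.
  - by move=> i _; rewrite /g; case: ifP.
  - by move=> i _ x _; rewrite /g; case: ifP => // _; rewrite normr0.
  - rewrite /g gtn_eqF ?q_gt0// Dz => j x xj.
    have ae : approx k M (G q) e.
      move=> i; exists 0; first by rewrite size_poly0.
      by move=> y yi; rewrite horner0 subr0; apply: Ge => //; exact: cell_sub yi.
    have := CpE (cG q (leqnn q)) ae xj; have := Ge q x (leqnn q) (cell_sub xj).
    set v := _.[x]; move=> H1 H2; have -> : v - 0 = (v - G q x) + G q x by ring.
    by apply: le_trans (ler_normD _ _) _; rewrite mulrDl mul1r lerD.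
  - by rewrite /g /= integ_cst ?(ltW hab)// divfK// gt_eqF.
have hkle : e * hk <= e.
  by rewrite ler_piMr// exprn_ile1// ltW// mesh_size_gt0.
have -> : stepC * (W * tau ^+ p.+1) = Num.sqrt (b - a) * (Cd * ((Cp + 1) * e + e) + e).
  by rewrite /stepC /e; ring.
have Z0 : 0 <= Cd * ((Cp + 1) * e + e) + e.
  by rewrite addr_ge0// mulr_ge0// addr_ge0// mulr_ge0// addr_ge0.
apply: (normV_bound hab Z0) => j x xj; rewrite subr0.
have := zd j x xj; rewrite /g /= => H.
set v := _.[x]; have -> : v = (v - d) + d by ring.
apply: le_trans (ler_normD _ _) _; rewrite lerD//; apply: le_trans H _.
by rewrite ler_wpM2l// lerD2l.
Qed.

Definition localC : R := stageC * (Num.sqrt (b - a) * projC) + stepC.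

Lemma local_error t : 0 <= t ->
  normV (Rs s alpha (tau *: Lh) (Pi 0 t) - Pi 0 (t + tau))
    <= tau * (localC * W * (hk + tau ^+ p)).
Proof.
move=> t0; set S := \sum_(i < s.+1) (alpha i * tau ^+ i) *: Pi i t.
have -> : Rs s alpha (tau *: Lh) (Pi 0 t) - Pi 0 (t + tau) =
   (Rs s alpha (tau *: Lh) (Pi 0 t) - S) + (-1) *: (Pi 0 (t + tau) - S).
  by rewrite scaleN1r opprB addrA subrK.
apply: le_trans (normVD _ _) _; rewrite normVZ normrN1 mul1r.
apply: le_trans (lerD (Rs_Pi t0) (step_Pi t0)) _.
have pC : 0 <= projC by rewrite addr_ge0// mulr_ge0// addr_ge0.
have A0 : 0 <= stageC * (Num.sqrt (b - a) * projC).
  by rewrite mulr_ge0 ?stageC_ge0// mulr_ge0// sqrtr_ge0.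
have tp : 0 <= tau ^+ p by rewrite exprn_ge0// ltW.
have -> : tau * (localC * W * (hk + tau ^+ p)) =
   stageC * (tau * Delta) + stepC * (W * tau ^+ p.+1)
   + tau * W * (stageC * (Num.sqrt (b - a) * projC) * tau ^+ p + stepC * hk).
  by rewrite /localC /Delta [tau ^+ p.+1]exprS; ring.
rewrite lerDl mulr_ge0//; first by rewrite mulr_ge0 ?W_ge0 ?(ltW tau0).
by rewrite addr_ge0// mulr_ge0 ?hk_ge0 ?stepC_ge0.
Qed.

(** Discrete Gronwall: the error starts at zero, and one step multiplies
    it by at most [1 + mu tau] and adds the local error. *)
Lemma global_error (mu : R) (uh : nat -> V) : 0 <= mu ->
  opnorm (Rs s alpha (tau *: Lh)) <= 1 + mu * tau ->
  uh 0%N = Pi 0 0 -> (forall n, uh n.+1 = Rs s alpha (tau *: Lh) (uh n)) ->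
  forall n, normV (uh n - Pi 0 (n%:R * tau))
    <= sigma_growth mu (n%:R * tau) * (localC * W * (hk + tau ^+ p)).
Proof.
move=> mu0 stab uh0 uhS; elim=> [|n IH].
  rewrite mul0r uh0 subrr normV0 /sigma_growth mulr0 expR0 subrr mul0r.
  by case: ifP; rewrite mul0r.
have tn : 0 <= n%:R * tau by rewrite mulr_ge0 ?ler0n// ltW.
have tS : n.+1%:R * tau = n%:R * tau + tau by rewrite -natr1 mulrDl mul1r.
set eta := localC * W * (hk + tau ^+ p) in IH *.
have eta0 : 0 <= eta.
  have := le_trans (normV_ge0 _) (local_error tn).
  by rewrite -/eta pmulr_rge0.
rewrite uhS; set Rn := Rs s alpha (tau *: Lh) in uhS stab *.
have -> : Rn (uh n) - Pi 0 (n.+1%:R * tau) =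
    Rn (uh n - Pi 0 (n%:R * tau)) + (Rn (Pi 0 (n%:R * tau)) - Pi 0 (n%:R * tau + tau)).
  by rewrite linearB /= addrA subrK tS.
apply: le_trans (normVD _ _) _.
have H1 : normV (Rn (uh n - Pi 0 (n%:R * tau))) <= (1 + mu * tau) * (sigma_growth mu (n%:R
  * tau) * eta).
  apply: le_trans (opnorm_bound _ _) _.
  apply: le_trans (ler_wpM2r (normV_ge0 _) stab) _.
  by rewrite ler_wpM2l// addr_ge0// mulr_ge0// ltW.
apply: le_trans (lerD H1 (local_error tn)) _; rewrite -/eta mulrA -mulrDl ler_wpM2r//.
exact: sigma_step.
Qed.

Definition finalC : R := 2 * (Num.sqrt (b - a) * (Cd * (Cp + 1)) + localC).

(** Split the error at [Pi u]; the squares of the two parts are added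
    to avoid a triangle inequality outside the discrete space. *)
Lemma total_error (mu : R) (uh : nat -> V) : 0 <= mu ->
  opnorm (Rs s alpha (tau *: Lh)) <= 1 + mu * tau ->
  uh 0%N = Pi 0 0 -> (forall n, uh n.+1 = Rs s alpha (tau *: Lh) (uh n)) ->
  forall n, L2norm a b (fun x => u (n%:R * tau) x - broken (uh n) x)
    <= finalC * W * (sigma_growth mu (n%:R * tau) + 1) * (hk + tau ^+ p).
Proof.
move=> mu0 stab uh0 uhS n; have ge := global_error mu0 stab uh0 uhS n.
set t := n%:R * tau in ge *.
have t0 : 0 <= t by rewrite mulr_ge0 ?ler0n// ltW.
have Whk : 0 <= W * hk by rewrite mulr_ge0 ?W_ge0 ?hk_ge0.
have ba : 0 <= b - a by rewrite subr_ge0 ltW.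
have tp : 0 <= tau ^+ p by rewrite exprn_ge0// ltW.
have sg := sigma_ge0 mu0 t0.
set e := uh n - Pi 0 t in ge *.
pose eps := Cd * (Cp * (W * hk) + W * hk).
have eps0 : 0 <= eps by rewrite mulr_ge0// addr_ge0// mulr_ge0.
have perr := Pi_err (leq0n s) t0; rewrite (Du_u Dsm t0) in perr.
have cu : continuous (u t) by rewrite -(Du_u Dsm t0); apply: c_Du.
pose X := Num.sqrt (b - a) * eps.
have X0 : 0 <= X by rewrite mulr_ge0 ?sqrtr_ge0.
have Y0 := normV_ge0 e.
have sq : ip a b (fun x => u t x - broken (uh n) x) (fun x => u t x - broken (uh n) x)
    <= (2 * (X + normV e)) ^+ 2.
  pose f (j : 'I_(ncell M)) x := u t x - (val (uh n j)).[x].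
  have cf j : continuous (f j) by apply: contB => //; exact: cont_poly.
  have fE (j : 'I_(ncell M)) x : node M j <= x < node M j.+1 -> u t x - broken (uh n) x = f j x.
    by move=> xj; rewrite (brokenE _ xj).
  rewrite (ip_cells cf cf fE fE).
  apply: le_trans (_ : 2 * X ^+ 2 + 2 * normV e ^+ 2 <= _); last first.
    by have := mulr_ge0 X0 Y0; have := sqr_ge0 X; have := sqr_ge0 (normV e);
      rewrite !expr2; nra.
  have -> : 2 * X ^+ 2 + 2 * normV e ^+ 2 = \sum_(j < ncell M)
      (2 * eps ^+ 2 * (node M j.+1 - node M j)
       + 2 * cellint j (horner (val (e j) * val (e j)))).
    by rewrite big_split /= -!mulr_sumr sum_cells -ipVE -normV_sqr exprMn sqr_sqrtr//; ring.
  apply: ler_sum => j _.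
  pose ee := val (e j) * val (e j).
  have cee : continuous (fun x => 2 * ee.[x]) by apply: contM;
    [exact: cont_cst|exact: cont_poly].
  rewrite -integ_cst ?(ltW (cell_lt j))// -cellintZ; last exact: cont_poly.
  rewrite -[leRHS]integD//; last exact: cont_cst.
  apply: le_integ => [||x xj]; first exact: contM (cf j) (cf j).
    by apply: contD => //; exact: cont_cst.
  have -> : f j x = (u t x - (val (Pi 0 t j)).[x]) - (val (e j)).[x].
    have -> : val (e j) = val (uh n j) - val (Pi 0 t j).
      by rewrite /e addrC -scaleN1r val_lin scaleN1r addrC.
    by rewrite /f !hornerS; ring.
  have := perr j x xj; rewrite distrC => H.
  have Hs : (u t x - (val (Pi 0 t j)).[x]) ^+ 2 <= eps ^+ 2.
    by rewrite -real_normK ?num_real// lerXn2r ?nnegrE.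
  rewrite /ee hornerM; move: Hs; set A := _ - _.[x]; set B' := (val (e j)).[x] => Hs.
  have := sqr_ge0 (A + B'); rewrite !expr2 in Hs *; lra.
rewrite /L2norm; apply: le_trans (_ : 2 * (X + normV e) <= _).
  rewrite -[leRHS]ger0_norm ?mulr_ge0 ?addr_ge0// -sqrtr_sqr; exact: ler_wsqrtr.
have lC : 0 <= localC.
  rewrite addr_ge0 ?stepC_ge0// mulr_ge0 ?stageC_ge0// mulr_ge0 ?sqrtr_ge0//.
  by rewrite addr_ge0// mulr_ge0// addr_ge0.
have XE : X = Num.sqrt (b - a) * (Cd * (Cp + 1)) * W * hk by rewrite /X /eps; ring.
pose c1 := Num.sqrt (b - a) * (Cd * (Cp + 1)).
have c10 : 0 <= c1 by rewrite mulr_ge0 ?sqrtr_ge0// mulr_ge0// addr_ge0.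
have W0 := W_ge0; have hk0 := hk_ge0.
have H1 : X <= c1 * W * (sigma_growth mu t + 1) * (hk + tau ^+ p).
  have c1W : 0 <= c1 * W by rewrite mulr_ge0.
  rewrite XE -/c1; apply: ler_pM => //.
    by apply: ler_peMr => //; rewrite lerDr.
  by rewrite lerDl.
have H2 : normV e <= localC * W * (sigma_growth mu t + 1) * (hk + tau ^+ p).
  apply: le_trans ge _; rewrite mulrA ler_wpM2r ?addr_ge0// [_ * (localC * W)]mulrC.
  by rewrite ler_wpM2l ?mulr_ge0// lerDl.
have -> : finalC * W * (sigma_growth mu t + 1) * (hk + tau ^+ p) =
  2 * (c1 * W * (sigma_growth mu t + 1) * (hk + tau ^+ p)
     + localC * W * (sigma_growth mu t + 1) * (hk + tau ^+ p)).
  by rewrite /finalC /c1; ring.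
by rewrite ler_wpM2l// lerD.
Qed.

End Evolution.

(** * The error estimate *)

Theorem mainTheorem5 (R : realType) (a b : R) (k q gamma p s : nat)
    (beta rho lambda : R) (theta alpha : nat -> R)
    (hab : a < b)
    (hq : (q = 2 * gamma /\ 1 <= gamma)%N \/ q = (2 * gamma + 1)%N)
    (hbeta : q = (2 * gamma)%N -> beta * (-1) ^+ gamma < 0)
    (htheta : forall i, (i <= gamma)%N -> theta i != 1 / 2)
    (htheta0 : q = (2 * gamma + 1)%N ->
       beta * (-1) ^+ gamma * (theta 0%N - 1 / 2) <= 0)
    (hp : (1 <= p)%N)
    (halpha : forall i, (i <= p)%N -> alpha i = 1 / (i`!)%:R)
    (halphap : alpha p.+1 != 1 / ((p.+1)`!)%:R)
    (halphas : forall i, (s < i)%N -> alpha i = 0)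
    (hlambda : lambda < 1) :
  exists (m : nat) (CE : R -> R),
  forall (u : R -> R -> R) (Du : nat -> nat -> R -> R -> R) (B : R),
    smooth_derivs m u Du ->
    (forall t x, 0 <= t -> u t (x + (b - a)) = u t x) ->
    (forall t x, 0 < t ->
       derive1 (fun r => u r x) t = beta * derive1n q (u t) x) ->
    (forall t, 0 <= t -> sobolev_norm a b m Du t <= B) ->
  forall (M : mesh a b) (tau mu : R) (uh : nat -> Vh M k),
    let h := mesh_size M in
    let Lh := Lop M k q gamma beta theta in
    quasi_uniform rho M ->
    h <= 1 ->
    0 < tau -> tau <= 1 ->
    tau * opnorm Lh <= lambda ->
    0 <= mu ->
    opnorm (Rs s alpha (tau *: Lh)) <= 1 + mu * tau ->
    uh 0%N = Pi_init M k q gamma theta (u 0) ->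
    (forall n, uh n.+1 = Rs s alpha (tau *: Lh) (uh n)) ->
  forall n : nat,
    L2norm a b (fun x => u (n%:R * tau) x - broken (uh n) x)
      <= CE B * (sigma_growth mu (n%:R * tau) + 1) * (h ^+ k.+1 + tau ^+ p).
Proof.
have hps : (p <= s)%N.
  rewrite leqNgt; apply/negP => /(halphas _) a0.
  have := halpha _ (leqnn p); rewrite a0 => /esym/eqP.
  by rewrite mulf_eq0 oner_eq0 invr_eq0 pnatr_eq0 eqn0Ngt fact_gt0.
have hsz : size (factors q gamma theta) = q.
  by apply: factors_size; case: hq => [[qE _]|qE]; [left|right].
have [Cp Cp0 CpE] := L2proj_error k hab.
have [Cd Cd0 CdE] := Dchain_error k hab (factors_ok q htheta).
rewrite hsz in CdE.
exists (s + q + k + 5)%N, (fun B => finalC a b s alpha Cp Cd * sup_const a b B).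
move=> u Du B Dsm per pde sob M tau mu uh h Lh _ h1 tau0 tau1 tauL mu0 stab uh0 uhS n.
have contr (v : Vh M k) : normV ((tau *: Lh) v) <= normV v.
  rewrite scale_lfunE normVZ gtr0_norm//.
  apply: le_trans (_ : tau * (opnorm Lh * normV v) <= _).
    by rewrite ler_wpM2l ?(ltW tau0)// opnorm_bound.
  rewrite mulrA ler_piMl ?normV_ge0//; exact: le_trans tauL (ltW hlambda).
apply: (total_error hab hq htheta halpha hps (leqnn _) Dsm per pde sob Cp0 Cd0 CpE CdE
  h1 tau0 tau1 contr mu0 stab _ uhS).
by rewrite uh0 /Pi (Du_u Dsm).
Qed.
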